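(* Let $k\subseteq K$ be fields of characteristic $p>0$, let $\mathfrak{g}$ be a $p$-$(k,K)$-Lie algebra, and let $x,y\in K_0(\mathbf{conn}\text{-}\mathfrak{g})$ be arbitrary elements with $x$ effective. Let $F:\mathfrak{h}\to\mathfrak{g}$ be a morphism in $Lie_{K/k}$. For every integer $l\ge 0$ the following hold: (1) $c_l(x+y)=\sum_{i+j=l}c_i(x)c_j(y)$; (2) $c_l(x)=0$ if $l>e(x)$; (3) $F^*c_l(x)=c_l(F^*x)$.
   Context: A $p$-$(k,K)$-Lie algebra (restricted Lie-Rinehart algebra) is a subset $\mathfrak{g}\subseteq Der_k(K)$ that is a $k$-Lie subalgebra and a $K$-vector subspace, such that $\partial^{[p]}=\partial\circ\cdots\circ\partial$ ($p$ times) lies in $\mathfrak{g}$ for all $\partial\in\mathfrak{g}$. A morphism $\mathfrak{h}\to\mathfrak{g}$ is an inclusion. $Lie_{K/k}$ is the resulting category. A $\mathfrak{g}$-connection is a pair $(V,\rho)$ with $V$ a finite dimensional $K$-vector space and $\rho:\mathfrak{g}\to End_k(V)$ a $K$-linear map with $\rho(\partial)(av)=a\rho(\partial)(v)+\partial(a)v$ for all $a\in K$, $v\in V$, $\partial\in\mathfrak{g}$. A map of $\mathfrak{g}$-connections $(V,\rho)\to(W,\eta)$ is a $K$-linear map $\phi:V\to W$ with $\phi\circ\rho(\partial)=\eta(\partial)\circ\phi$ for all $\partial\in\mathfrak{g}$. $\mathbf{conn}\text{-}\mathfrak{g}$ is the category of $\mathfrak{g}$-connections (not necessarily flat). Tensor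 products (over $K$) and exterior powers of connections are connections via the Leibniz rule. $K_0(\mathbf{conn}\text{-}\mathfrak{g})$ is the Grothendieck ring of this category (with respect to short exact sequences; addition from $\oplus$, multiplication from $\otimes_K$). For $F:\mathfrak{h}\to\mathfrak{g}$, $F^*:K_0(\mathbf{conn}\text{-}\mathfrak{g})\to K_0(\mathbf{conn}\text{-}\mathfrak{h})$ is induced by restricting a $\mathfrak{g}$-connection $(W,\rho)$ to the $\mathfrak{h}$-connection $(W,\rho\circ F)$. The operations $\lambda^l$ are determined by $\lambda^l[V,\rho]=[\wedge^lV,\wedge^l\rho]$ and the requirement that $\lambda_t(x)=\sum_{l\ge 0}\lambda^l(x)t^l$ defines a group homomorphism from $K_0(\mathbf{conn}\text{-}\mathfrak{g})$ to the multiplicative group $1+K_0(\mathbf{conn}\text{-}\mathfrak{g})[[t]]$ of power series with constant term $1$. With $u=t/(1-t)$, the operations $\gamma^l$ are defined by $\gamma_t(x)=\lambda_u(x)=\sum_{l\ge0}\lambda^l(x)u^l=\sum_{l\ge0}\gamma^l(x)t^l$. For $x=\sum_i n_i[V_i,\rho_i]$ put $e(x)=\sum_i n_i\dim_K(V_i)$, $d(x)=e(x)[\theta_K]$, where $\theta_K$ is the trivial rank one $\mathfrak{g}$-connection ($K$ with $\partial$ acting as the derivation $\partial$), and $c_l(x)=(-1)^l\gamma^l(x-d(x))\in K_0(\mathbf{conn}\text{-}\mathfrak{g})$. The element $x$ is effective if it can be written $x=\sum_i n_i[V_i]$ with $n_i>0$ for all $i$. *)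

(* Defs.v *)
From HB Require Import structures.
From mathcomp Require Import all_boot all_order all_algebra.
From mathcomp Require Import fingroup perm.
From mathcomp Require Import generic_quotient ring_quotient.
From mathcomp Require Import boolp.
From mathcomp Require Import freeg ring.

Set Implicit Arguments.
Unset Strict Implicit.
Unset Printing Implicit Defensive.

Import GRing.Theory VectorInternalTheory.
Local Open Scope ring_scope.

Section PLieAlgebras.
Variable K : fieldType.
Implicit Types (k : {pred K}) (D : K -> K).

Definition is_derivation k D : Prop :=
  [/\ forall x y, D (x + y) = D x + D y,
      forall a x, a \in k -> D (a * x) = a * D x
    & forall x y, D (x * y) = D x * y + x * D y].

(* A subfield [k] of [K] is a [divringClosed] subset. Closure under addition,  *)
(* opposite and scaling by [k] follows from closure under [K]-combinations.   *)
Record pLieAlg (p : nat) (k : divringClosed K) := PLieAlg {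
  pLie_set :> (K -> K) -> Prop;
  pLie_der : forall D, pLie_set D -> is_derivation k D;
  pLie_zero : pLie_set (fun=> 0);
  pLie_comb : forall a D1 D2, pLie_set D1 -> pLie_set D2 ->
    pLie_set (fun x => a * D1 x + D2 x);
  pLie_bracket : forall D1 D2, pLie_set D1 -> pLie_set D2 ->
    pLie_set (fun x => D1 (D2 x) - D2 (D1 x));
  pLie_ppow : forall D, pLie_set D -> pLie_set (iter p D)
}.

End PLieAlgebras.

Section Connections.
Variables (K : fieldType) (p : nat) (k : divringClosed K) (g : pLieAlg p k).

Definition pLie_elt := {D : K -> K | g D}.

Definition elt_fun (D : pLie_elt) : K -> K := sval D.
Coercion elt_fun : pLie_elt >-> Funclass.

Definition elt_comb (a : K) (D1 D2 : pLie_elt) : pLie_elt :=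
  exist _ (fun x => a * D1 x + D2 x) (pLie_comb a (svalP D1) (svalP D2)).

(* The first two conditions say that the values lie in [End_k(V)].             *)
Record connection (V : vectType K) := Connection {
  nabla :> pLie_elt -> V -> V;
  nablaD : forall D u v, nabla D (u + v) = nabla D u + nabla D v;
  nablaZk : forall D c v, c \in k -> nabla D (c *: v) = c *: nabla D v;
  nabla_comb : forall a D1 D2 v,
    nabla (elt_comb a D1 D2) v = a *: nabla D1 v + nabla D2 v;
  nabla_Leibniz : forall (D : pLie_elt) a v,
    nabla D (a *: v) = a *: nabla D v + D a *: v
}.

Record conn := Conn {
  conn_space :> vectType K;
  conn_nabla :> connection conn_space
}.

Definition conn_map (V W : conn) (f : 'Hom(V, W)) : Prop :=
  forall D v, f (conn_nabla V D v) = conn_nabla W D (f v).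

Definition short_exact (V' V V'' : conn) (i : 'Hom(V', V)) (q : 'Hom(V, V''))
    : Prop :=
  [/\ conn_map i, conn_map q, lker i = 0%VS, limg i = lker q
    & limg q = fullv].

Lemma eltD (D : pLie_elt) x y : D (x + y) = D x + D y.
Proof. by have [] := pLie_der (svalP D). Qed.
Lemma eltZ (D : pLie_elt) c x : c \in k -> D (c * x) = c * D x.
Proof. by have [_ + _] := pLie_der (svalP D); apply. Qed.
Lemma eltM (D : pLie_elt) x y : D (x * y) = D x * y + x * D y.
Proof. by have [] := pLie_der (svalP D). Qed.
Lemma elt0 (D : pLie_elt) : D 0 = 0.
Proof. by apply: (addrI (D 0)); rewrite -eltD !addr0. Qed.
Lemma elt1 (D : pLie_elt) : D 1 = 0.
Proof.
by apply: (addrI (D 1)); rewrite addr0 -[in RHS](mulr1 1) eltM mulr1 mul1r.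
Qed.
Lemma eltk (D : pLie_elt) c : c \in k -> D c = 0.
Proof. by move=> ck; rewrite -[c]mulr1 eltZ // elt1 mulr0. Qed.
Lemma eltN (D : pLie_elt) x : D (- x) = - D x.
Proof. by apply: (addrI (D x)); rewrite -eltD !subrr elt0. Qed.
Lemma elt_sum (D : pLie_elt) I (r : seq I) P (F : I -> K) :
  D (\sum_(i <- r | P i) F i) = \sum_(i <- r | P i) D (F i).
Proof. by apply: (big_morph D (eltD D) (elt0 D)). Qed.

Lemma nabla0 (V : vectType K) (N : connection V) D : N D 0 = 0.
Proof. by apply: (addrI (N D 0)); rewrite -nablaD !addr0. Qed.
Lemma nabla_sum (V : vectType K) (N : connection V) D I (r : seq I) P F :
  N D (\sum_(i <- r | P i) F i) = \sum_(i <- r | P i) N D (F i).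
Proof. by apply: (big_morph (N D) (nablaD N D) (nabla0 N D)). Qed.

(* An additive, Leibniz operator is automatically [k]-linear.                  *)
Program Definition mk_connection (V : vectType K) (N : pLie_elt -> V -> V)
    (ND : forall D u v, N D (u + v) = N D u + N D v)
    (NC : forall a D1 D2 v, N (elt_comb a D1 D2) v = a *: N D1 v + N D2 v)
    (NL : forall (D : pLie_elt) a v, N D (a *: v) = a *: N D v + D a *: v) :=
  @Connection V N ND _ NC NL.
Next Obligation. by rewrite NL eltk // scale0r addr0. Qed.

End Connections.

Section Constructions.
Variables (K : fieldType) (p : nat) (k : divringClosed K) (g : pLieAlg p k).
Implicit Types V W U : conn g.

Program Definition theta : conn g :=
  @Conn K p k g K^o (@mk_connection K p k g K^o (fun D (x : K^o) => D x) _ _ _).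
Next Obligation. exact: (eltD D u v). Qed.
Next Obligation. by apply: etrans (eltM D a v) _; exact: addrC. Qed.

Definition tensor_space V W : vectType K := 'M[K]_(dim V, dim W).

(* The coordinates of [v ⊗ w] in the basis [e_i ⊗ f_j].                        *)
Definition tensor V W (v : V) (w : W) : tensor_space V W :=
  (v2r v)^T *m v2r w.

Definition basis V (i : 'I_(dim V)) : V := r2v (delta_mx 0 i).

(* The Leibniz rule in coordinates; see [tensor_nabla_tensor].                 *)
Definition tensor_nabla V W (D : pLie_elt g) (M : tensor_space V W) :
    tensor_space V W :=
  \sum_i \sum_j (D (M i j) *: tensor (basis i) (basis j) +
     M i j *: (tensor (conn_nabla V D (basis i)) (basis j) +
               tensor (basis i) (conn_nabla W D (basis j)))).

Lemma basis_sum V (v : V) : v = \sum_i v2r v 0 i *: basis i.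
Proof.
apply: v2r_inj; rewrite linear_sum [LHS]row_sum_delta.
by apply: eq_bigr => i _; rewrite linearZ /= r2vK.
Qed.

Lemma tensorDl V W (v v' : V) (w : W) :
  tensor (v + v') w = tensor v w + tensor v' w.
Proof. by rewrite /tensor linearD linearD mulmxDl. Qed.
Lemma tensorDr V W (v : V) (w w' : W) :
  tensor v (w + w') = tensor v w + tensor v w'.
Proof. by rewrite /tensor linearD mulmxDr. Qed.
Lemma tensorZl V W a (v : V) (w : W) : tensor (a *: v) w = a *: tensor v w.
Proof. by rewrite /tensor linearZ linearZ -scalemxAl. Qed.
Lemma tensorZr V W a (v : V) (w : W) : tensor v (a *: w) = a *: tensor v w.
Proof. by rewrite /tensor linearZ -scalemxAr. Qed.
Lemma tensor0l V W (w : W) : tensor (0 : V) w = 0.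
Proof. by rewrite /tensor linear0 trmx0 mul0mx. Qed.
Lemma tensor0r V W (v : V) : tensor v (0 : W) = 0.
Proof. by rewrite /tensor linear0 mulmx0. Qed.
Lemma tensor_suml V W I (r : seq I) P (F : I -> V) (w : W) :
  tensor (\sum_(i <- r | P i) F i) w = \sum_(i <- r | P i) tensor (F i) w.
Proof. exact: (big_morph (fun v => tensor v w) (fun x y => tensorDl x y w) (tensor0l _ w)). Qed.
Lemma tensor_sumr V W I (r : seq I) P (v : V) (F : I -> W) :
  tensor v (\sum_(i <- r | P i) F i) = \sum_(i <- r | P i) tensor v (F i).
Proof. exact: (big_morph (tensor v) (tensorDr v) (tensor0r _ v)). Qed.

Lemma tensor_basisE V W i j (a : 'I_(dim V)) (b : 'I_(dim W)) :
  (tensor (basis a) (basis b) : 'M_(_, _)) i j = ((i == a) && (j == b))%:R.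
Proof.
rewrite /tensor /basis !r2vK trmx_delta mul_delta_mx_cond eqxx mulr1n.
by rewrite mxE.
Qed.

Lemma tensor_coef V W (v : V) (w : W) i j :
  (tensor v w : 'M_(_, _)) i j = v2r v 0 i * v2r w 0 j.
Proof. by rewrite /tensor mxE big_ord1 mxE. Qed.

Lemma tensor_sumE V W (M : tensor_space V W) :
  M = \sum_i \sum_j M i j *: tensor (basis i) (basis j).
Proof.
rewrite [LHS]matrix_sum_delta; apply: eq_bigr => i _; apply: eq_bigr => j _.
by rewrite /tensor /basis !r2vK trmx_delta mul_delta_mx_cond eqxx mulr1n.
Qed.

Lemma tensor_nablaD V W D (M N : tensor_space V W) :
  tensor_nabla D (M + N) = tensor_nabla D M + tensor_nabla D N.
Proof.
rewrite -big_split; apply: eq_bigr => i _; rewrite -big_split.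
by apply: eq_bigr => j _; rewrite /= mxE eltD !scalerDl addrACA.
Qed.

Lemma tensor_nabla_Leibniz V W (D : pLie_elt g) a (M : tensor_space V W) :
  tensor_nabla D (a *: M) = a *: tensor_nabla D M + D a *: M.
Proof.
rewrite [in X in _ + X](tensor_sumE M) !scaler_sumr -big_split.
apply: eq_bigr => i _; rewrite !scaler_sumr -big_split.
apply: eq_bigr => j _; rewrite /= mxE eltM !scalerDl !scalerDr !scalerA.
by rewrite -!addrA [LHS]addrC -!addrA.
Qed.

Lemma tensor_nabla_comb V W a D1 D2 (M : tensor_space V W) :
  tensor_nabla (elt_comb a D1 D2) M =
  a *: tensor_nabla D1 M + tensor_nabla D2 M.
Proof.
rewrite !scaler_sumr -big_split; apply: eq_bigr => i _.
rewrite !scaler_sumr -big_split; apply: eq_bigr => j _ /=.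
rewrite !nabla_comb tensorDl tensorDr tensorZl tensorZr.
apply/matrixP => x y; rewrite !(mxE, tensor_coef) /=; ring.
Qed.

Definition tensor_conn V W : conn g :=
  Conn (mk_connection (@tensor_nablaD V W) (@tensor_nabla_comb V W)
          (@tensor_nabla_Leibniz V W)).

Lemma tensor_nabla_tensor V W D (v : V) (w : W) :
  tensor_nabla D (tensor v w) =
  tensor (conn_nabla V D v) w + tensor v (conn_nabla W D w).
Proof.
pose N := conn_nabla (tensor_conn V W).
have ND u u' : tensor_nabla D (u + u') = tensor_nabla D u + tensor_nabla D u'.
  exact: tensor_nablaD.
have Nsum I (r : seq I) P (F : I -> tensor_space V W) :
    tensor_nabla D (\sum_(i <- r | P i) F i) =
    \sum_(i <- r | P i) tensor_nabla D (F i).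
  exact: (@nabla_sum _ _ _ _ (tensor_conn V W) N D).
have Nb i j : tensor_nabla D (tensor (basis i) (basis j) : tensor_space V W) =
    tensor (conn_nabla V D (basis i)) (basis j) +
    tensor (basis i) (conn_nabla W D (basis j)).
  rewrite /tensor_nabla (bigD1 i) //= [X in _ + X]big1 ?addr0; last first.
    move=> a /negPf ai; apply: big1 => b _.
    by rewrite tensor_basisE ai /= elt0 !scale0r addr0.
  rewrite (bigD1 j) //= [X in _ + X]big1 ?addr0; last first.
    move=> b /negPf bj.
    by rewrite tensor_basisE bj andbF /= elt0 !scale0r addr0.
  by rewrite tensor_basisE !eqxx elt1 scale0r add0r scale1r.
rewrite (basis_sum v) (basis_sum w).
move: (v2r v 0) (v2r w 0) => {}v {}w.
rewrite !nabla_sum !tensor_suml Nsum -big_split; apply: eq_bigr => i _ /=.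
rewrite !tensor_sumr Nsum -big_split; apply: eq_bigr => j _ /=.
rewrite !nabla_Leibniz tensorZl tensorZr !tensor_nabla_Leibniz Nb.
rewrite !tensorDl !tensorDr !tensorZl !tensorZr.
apply/matrixP => x y; rewrite !(mxE, tensor_coef) /=; ring.
Qed.

Definition tensor_lift V W (U : vectType K) (b : V -> W -> U) (M : tensor_space V W) : U :=
  \sum_i \sum_j M i j *: b (basis i) (basis j).

Lemma tensor_lift_linear V W (U : vectType K) (b : V -> W -> U) :
  linear (tensor_lift b).
Proof.
move=> a M N; rewrite /tensor_lift scaler_sumr -big_split; apply: eq_bigr => i _.
rewrite scaler_sumr -big_split; apply: eq_bigr => j _ /=.
by rewrite !mxE scalerDl scalerA.
Qed.
HB.instance Definition _ V W U b :=
  GRing.isLinear.Build K _ _ _ (@tensor_lift V W U b) (@tensor_lift_linear V W U b).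

Lemma tensor_liftE V W (U : vectType K) (b : V -> W -> U) :
  (forall a v v' w, b (a *: v + v') w = a *: b v w + b v' w) ->
  (forall a v w w', b v (a *: w + w') = a *: b v w + b v w') ->
  forall v w, tensor_lift b (tensor v w) = b v w.
Proof.
move=> bl br v w.
have b0l w' : b 0 w' = 0.
  by have := bl (-1) 0 0 w'; rewrite scaler0 addr0 scaleN1r addNr.
have b0r v' : b v' 0 = 0.
  by have := br (-1) v' 0 0; rewrite scaler0 addr0 scaleN1r addNr.
have bDl v1 v2 w' : b (v1 + v2) w' = b v1 w' + b v2 w'.
  by have := bl 1 v1 v2 w'; rewrite !scale1r.
have bDr v' w1 w2 : b v' (w1 + w2) = b v' w1 + b v' w2.
  by have := br 1 v' w1 w2; rewrite !scale1r.
have bZl a v' w' : b (a *: v') w' = a *: b v' w'.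
  by have := bl a v' 0 w'; rewrite b0l !addr0.
have bZr a v' w' : b v' (a *: w') = a *: b v' w'.
  by have := br a v' w' 0; rewrite b0r !addr0.
transitivity (b (\sum_i v2r v 0 i *: basis i) (\sum_i v2r w 0 i *: basis i)).
  rewrite (big_morph (fun x => b x _) (fun x y => bDl x y _) (b0l _)).
  apply: eq_bigr => i _.
  rewrite (big_morph (b _) (bDr _) (b0r _)); apply: eq_bigr => j _.
  by rewrite bZl bZr scalerA tensor_coef.
by rewrite -!basis_sum.
Qed.

Lemma tensor_ind V W (U : zmodType) (f h : tensor_space V W -> U) :
  {morph f : x y / x + y} -> {morph h : x y / x + y} ->
  (forall v w, f (tensor v w) = h (tensor v w)) -> f =1 h.
Proof.
move=> fD hD fh M; rewrite (tensor_sumE M).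
have z (e : tensor_space V W -> U) : {morph e : x y / x + y} -> e 0 = 0.
  by move=> eD; apply: (addrI (e 0)); rewrite -eD !addr0.
rewrite !(big_morph f fD (z _ fD)) !(big_morph h hD (z _ hD)).
apply: eq_bigr => i _.
rewrite !(big_morph f fD (z _ fD)) !(big_morph h hD (z _ hD)).
by apply: eq_bigr => j _; rewrite -tensorZl fh.
Qed.

End Constructions.

Section GrothendieckGroup.
Variables (K : fieldType) (p : nat) (k : divringClosed K) (g : pLieAlg p k).
Implicit Types V W U : conn g.

(* [conn-g] is essentially small: every connection is isomorphic to one on     *)
(* some [K^n]; these are the generators of [K_0].                              *)
Definition gen := {n : nat & connection g 'rV[K]_n}.

HB.instance Definition _ := gen_eqMixin gen.
HB.instance Definition _ := gen_choiceMixin gen.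

Definition gen_conn (x : gen) : conn g := Conn (projT2 x).

Definition coord_nabla V (D : pLie_elt g) (r : 'rV[K]_(dim V)) : 'rV[K]_(dim V) :=
  v2r (conn_nabla V D (r2v r)).

Lemma coord_nablaD V D u v :
  @coord_nabla V D (u + v) = coord_nabla D u + coord_nabla D v.
Proof. by rewrite /coord_nabla linearD nablaD linearD. Qed.
Lemma coord_nabla_comb V a D1 D2 v :
  @coord_nabla V (elt_comb a D1 D2) v =
  a *: coord_nabla D1 v + coord_nabla D2 v.
Proof. by rewrite /coord_nabla nabla_comb linearP. Qed.
Lemma coord_nabla_Leibniz V (D : pLie_elt g) a v :
  @coord_nabla V D (a *: v) = a *: coord_nabla D v + D a *: v.
Proof. by rewrite /coord_nabla linearZ nabla_Leibniz linearP linearZ /= r2vK. Qed.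

Definition gen_of V : gen :=
  existT _ (dim V) (mk_connection (@coord_nablaD V) (@coord_nabla_comb V)
                      (@coord_nabla_Leibniz V)).

Definition ses_rel (r : {freeg gen / int}) : Prop :=
  exists (x' x x'' : gen) (i : 'Hom(gen_conn x', gen_conn x))
      (q : 'Hom(gen_conn x, gen_conn x'')),
    @short_exact K p k g (gen_conn x') (gen_conn x) (gen_conn x'') i q /\
    r = << x >> - << x' >> - << x'' >>.

Definition ses_span (x : {freeg gen / int}) : Prop :=
  exists s : seq (int * {freeg gen / int}),
    (forall r, r \in s -> ses_rel r.2) /\ x = \sum_(r <- s) r.2 *~ r.1.

Definition ses_sub : {pred {freeg gen / int}} := [pred x | `[< ses_span x >]].

Lemma ses_sub_zmod_closed : zmod_closed ses_sub.
Proof.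
split=> [|x y /asboolP[s [hs ->]] /asboolP[t [ht ->]]]; apply/asboolP.
  by exists [::]; split=> //; rewrite big_nil.
exists (s ++ [seq (- r.1, r.2) | r <- t]); split=> [r|].
  by rewrite mem_cat => /orP[/hs//|/mapP[r' /ht rr' ->]].
rewrite big_cat big_map /= -sumrN; congr (_ + _).
by apply: eq_bigr => r _; rewrite mulrNz.
Qed.
HB.instance Definition _ := GRing.isZmodClosed.Build _ ses_sub
  ses_sub_zmod_closed.

Definition K0 := Quotient.quot ses_sub.

HB.instance Definition _ := Choice.on K0.
HB.instance Definition _ := GRing.Zmodule.on K0.

Definition K0_class V : K0 := \pi_(K0)%qT << gen_of V >>.

End GrothendieckGroup.

Section ExactSequences.
Variables (K : fieldType) (p : nat) (k : divringClosed K) (g : pLieAlg p k).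
Implicit Types V W U : conn g.

Lemma short_exact_split V' V V'' (i : 'Hom(V', V)) (q : 'Hom(V, V'')) :
  @short_exact K p k g V' V V'' i q <->
  [/\ conn_map i, @conn_map _ _ _ _ V V'' q &
    exists (r : 'Hom(V, V')) (s : 'Hom(V'', V)),
      [/\ forall x, r (i x) = x, forall x, q (s x) = x, forall x, q (i x) = 0
        & forall x, i (r x) + s (q x) = x]].
Proof.
split=> [[ci cq i0 iq q1]|[ci cq [r [s [ri qs qi irsq]]]]]; last first.
  split=> //.
  - apply/eqP/lker0P => x y xy; by rewrite -(ri x) xy ri.
  - apply/vspaceP => x; rewrite memv_ker; apply/memv_imgP/eqP => [[y _ ->]//|qx].
    by exists (r x); rewrite ?memvf // -[LHS]irsq qx linear0 addr0.
  - apply/eqP; rewrite eqEsubv subvf; apply/subvP => x _.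
    by rewrite -(qs x) memv_img ?memvf.
split=> //.
have iinj : lker i == 0%VS by rewrite i0.
have qs x : q ((q^-1)%VF x) = x by apply: limg_lfunVK; rewrite q1 memvf.
have qi x : q (i x) = 0.
  by apply/eqP; rewrite -memv_ker -iq memv_img ?memvf.
pose e : 'Hom(V, V) := \1%VF - (q^-1 \o q)%VF.
exists (i^-1 \o e)%VF, (q^-1)%VF; split=> // [x|x].
- by rewrite comp_lfunE /e add_lfunE opp_lfunE id_lfunE comp_lfunE qi linear0 subr0 lker0_lfunK.
- rewrite comp_lfunE /e add_lfunE opp_lfunE id_lfunE comp_lfunE limg_lfunVK ?subrK //.
  by rewrite iq memv_ker linearB /= qs subrr.
Qed.

Definition iso V W : Prop :=
  exists (f : 'Hom(V, W)) (h : 'Hom(W, V)),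
    [/\ @conn_map _ _ _ _ V W f, forall x, h (f x) = x & forall x, f (h x) = x].

Lemma mk_iso V W (f : V -> W) (h : W -> V) : linear f -> linear h ->
  (forall D v, f (conn_nabla V D v) = conn_nabla W D (f v)) ->
  cancel f h -> cancel h f -> iso V W.
Proof.
move=> fl hl fD fh hf.
pose fL := GRing.isLinear.Build K _ _ _ f fl.
pose hL := GRing.isLinear.Build K _ _ _ h hl.
pose f' : {linear V -> W} := HB.pack f fL.
pose h' : {linear W -> V} := HB.pack h hL.
exists (linfun f'), (linfun h'); split=> [D v|x|x]; rewrite !lfunE /=.
- exact: fD.
- exact: fh.
- exact: hf.
Qed.

Lemma iso_refl V : iso V V.
Proof. by apply: (@mk_iso V V id id). Qed.

Lemma iso_sym V W : iso V W -> iso W V.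
Proof.
case=> f [h [fD hf fh]]; exists h, f; split=> // D v.
by rewrite -{1}(fh v) -fD hf.
Qed.

Lemma iso_trans V W U : iso V W -> iso W U -> iso V U.
Proof.
case=> f [h [fD hf fh]] [f' [h' [fD' hf' fh']]].
exists (f' \o f)%VF, (h \o h')%VF; split=> [D v|x|x]; rewrite !comp_lfunE.
- by rewrite fD fD'.
- by rewrite hf' hf.
- by rewrite fh fh'.
Qed.

Lemma iso_gen_of V : iso V (gen_conn (gen_of V)).
Proof.
apply: (@mk_iso V (gen_conn (gen_of V)) v2r r2v).
- by move=> a u w; apply: (linearP (@v2r K V)).
- by move=> a u w; apply: (linearP (@r2v K V)).
- by move=> D v /=; rewrite /coord_nabla v2rK.
- exact: v2rK.
- exact: r2vK.
Qed.

Lemma short_exact_iso V' V V'' W' W W'' (i : 'Hom(V', V)) (q : 'Hom(V, V'')) :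
  @short_exact K p k g V' V V'' i q -> iso V' W' -> iso V W -> iso V'' W'' ->
  exists (i' : 'Hom(W', W)) (q' : 'Hom(W, W'')),
    @short_exact K p k g W' W W'' i' q'.
Proof.
move=> /short_exact_split[ci cq [r [s [ri qs qi irsq]]]].
move=> I1 [f2 [h2 [c2 hf2 fh2]]] [f3 [h3 [c3 hf3 fh3]]].
have [h1 [f1 [d1 fh1 hf1]]] := iso_sym I1.
have [h2' [f2' [d2' _ _]]] := iso_refl V.
have d2 D w : h2 (conn_nabla W D w) = conn_nabla V D (h2 w).
  by rewrite -{1}(fh2 w) -c2 hf2.
exists (f2 \o i \o h1)%VF, (f3 \o q \o h2)%VF; apply/short_exact_split; split.
- by move=> D w; rewrite !comp_lfunE d1 ci c2.
- by move=> D w; rewrite !comp_lfunE d2 cq c3.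
exists (f1 \o r \o h2)%VF, (f2 \o s \o h3)%VF; split=> x; rewrite !comp_lfunE.
- by rewrite hf2 ri fh1.
- by rewrite hf2 qs fh3.
- by rewrite hf2 qi linear0.
- by rewrite hf1 hf3 -[RHS]fh2 -[in RHS](irsq (h2 x)) [in RHS]linearD.
Qed.

Lemma pi_ses V' V V'' (x' x x'' : gen g) (i : 'Hom(V', V)) (q : 'Hom(V, V'')) :
  @short_exact K p k g V' V V'' i q ->
  iso V' (gen_conn x') -> iso V (gen_conn x) -> iso V'' (gen_conn x'') ->
  \pi_(K0 g)%qT << x >> = \pi_(K0 g)%qT << x' >> + \pi_(K0 g)%qT << x'' >>.
Proof.
move=> iq I1 I2 I3; have [i' [q' iq']] := short_exact_iso iq I1 I2 I3.
rewrite -[RHS](@Quotient.pi_add _ (@ses_sub K p k g)); apply/eqP.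
rewrite eqmodE /= Quotient.equivE; apply/asboolP.
exists [:: (1, << x >> - << x' >> - << x'' >>)]; split=> [r|].
  by rewrite inE => /eqP-> /=; exists x', x, x'', i', q'.
by rewrite big_seq1 /= mulr1z opprD addrA.
Qed.

Lemma K0_class_ses V' V V'' (i : 'Hom(V', V)) (q : 'Hom(V, V'')) :
  @short_exact K p k g V' V V'' i q ->
  K0_class V = K0_class V' + K0_class V''.
Proof. by move=> /pi_ses; apply; exact: iso_gen_of. Qed.

Program Definition zero_conn : conn g :=
  @Conn K p k g 'rV[K]_0 (@mk_connection K p k g 'rV[K]_0 (fun D x => 0) _ _ _).
Next Obligation. by rewrite addr0. Qed.
Next Obligation. by rewrite addr0 scaler0. Qed.
Next Obligation. by rewrite [v]thinmx0 !scaler0 addr0. Qed.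

Lemma iso_ses V W : iso V W ->
  exists (i : 'Hom(V, W)) (q : 'Hom(W, zero_conn)), @short_exact K p k g V W zero_conn i q.
Proof.
case=> f [h [fD hf fh]]; exists f, (0 : 'Hom(_, _)); apply/short_exact_split; split=> //.
  by move=> D v; rewrite !zero_lfunE.
exists h, (0 : 'Hom(_, _)); split=> // x; rewrite ?zero_lfunE ?addr0 //.
by rewrite [RHS](thinmx0 (x : 'rV_0)).
Qed.

Lemma K0_class0 : K0_class zero_conn = 0.
Proof.
have [i [q /K0_class_ses/esym]] := iso_ses (iso_refl zero_conn).
by move/(canRL (addrK _)); rewrite subrr.
Qed.

Lemma K0_class_iso V W : iso V W -> K0_class V = K0_class W.
Proof.
by move=> /iso_ses[i [q /K0_class_ses->]]; rewrite K0_class0 addr0.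
Qed.

Lemma K0_class_gen (x : gen g) : \pi_(K0 g)%qT << x >> = K0_class (gen_conn x).
Proof.
have [i [q iq]] := iso_ses (iso_refl (gen_conn x)).
have := pi_ses iq (iso_refl _) (iso_gen_of _) (iso_gen_of _).
by rewrite -/(K0_class _) -/(K0_class zero_conn) K0_class0 addr0.
Qed.

Lemma K0_classE (x : gen g) V : iso V (gen_conn x) ->
  \pi_(K0 g)%qT << x >> = K0_class V.
Proof. by rewrite K0_class_gen => /K0_class_iso. Qed.

End ExactSequences.

Lemma K0_piB (K : fieldType) (p : nat) (k : divringClosed K) (g : pLieAlg p k)
    (D1 D2 : {freeg (gen g) / int}) :
  \pi_(K0 g)%qT (D1 - D2) = \pi_(K0 g)%qT D1 - \pi_(K0 g)%qT D2.
Proof.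
rewrite [LHS](@Quotient.pi_add _ (@ses_sub K p k g)).
by rewrite (@Quotient.pi_opp _ (@ses_sub K p k g)).
Qed.

Section Lifting.
Variables (K : fieldType) (p : nat) (k : divringClosed K) (g : pLieAlg p k).
Variables (U : zmodType) (phi : gen g -> U).

Definition freeg_lift (D : {freeg (gen g) / int}) : U :=
  \sum_(z <- dom D) phi z *~ coeff z D.

(* The value at [\sum_i n_i [V_i]] is [\sum_i n_i phi(V_i)]; independent of    *)
(* the representative when [phi] is additive on short exact sequences, see     *)
(* [K0_lift_pi].                                                               *)
Definition K0_lift (x : K0 g) : U := freeg_lift (repr x).

Lemma freeg_liftE D : freeg_lift D = fglift (phi : gen g -> ssrint.zmodule U) D.
Proof.
pose f := fglift (phi : gen g -> ssrint.zmodule U).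
have fB : {morph f : x y / x - y} by exact: lift_is_additive.
pose F : {additive {freeg (gen g) / int} -> ssrint.zmodule U} :=
  HB.pack f (GRing.isZmodMorphism.Build _ _ f fB).
rewrite -[RHS]/(F D) -[in RHS](freeg_sumE D) (raddf_sum F).
by apply: eq_bigr => z _; rewrite /= /f liftU.
Qed.

Lemma freeg_liftB D1 D2 : freeg_lift (D1 - D2) = freeg_lift D1 - freeg_lift D2.
Proof. by rewrite !freeg_liftE lift_is_additive. Qed.
HB.instance Definition _ := GRing.isZmodMorphism.Build _ _ freeg_lift freeg_liftB.

Lemma freeg_liftU z : freeg_lift << z >> = phi z.
Proof. by rewrite freeg_liftE liftU scale1r. Qed.

Definition ses_additive : Prop :=
  forall (x' x x'' : gen g) (i : 'Hom(gen_conn x', gen_conn x))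
      (q : 'Hom(gen_conn x, gen_conn x'')),
    @short_exact K p k g (gen_conn x') (gen_conn x) (gen_conn x'') i q ->
    phi x = phi x' + phi x''.

Hypothesis phi_ses : ses_additive.

Lemma freeg_lift_ses D : D \in @ses_sub K p k g -> freeg_lift D = 0.
Proof.
move=> /asboolP[s [hs ->]]; rewrite raddf_sum big_seq big1 // => r /hs.
move=> [x' [x [x'' [i [q [/phi_ses e ->]]]]]].
by rewrite raddfMz !raddfB /= !freeg_liftU e [phi x' + _]addrC addrK subrr mul0rz.
Qed.

Lemma K0_lift_pi D : K0_lift (\pi_(K0 g)%qT D) = freeg_lift D.
Proof.
apply/eqP; rewrite -subr_eq0 -raddfB; apply/eqP/freeg_lift_ses.
by rewrite Quotient.idealrBE reprK.
Qed.

Lemma K0_liftB x y : K0_lift (x - y) = K0_lift x - K0_lift y.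
Proof.
rewrite -[x]reprK -[y]reprK -K0_piB !K0_lift_pi.
exact: raddfB.
Qed.

Lemma K0_lift_gen z : K0_lift (\pi_(K0 g)%qT << z >>) = phi z.
Proof. by rewrite K0_lift_pi freeg_liftU. Qed.

End Lifting.

Lemma K0_ext (K : fieldType) (p : nat) (k : divringClosed K) (g : pLieAlg p k)
    (U : zmodType) (f h : K0 g -> U) :
  {morph f : x y / x - y} -> {morph h : x y / x - y} ->
  (forall z : gen g, f (K0_class (gen_conn z)) = h (K0_class (gen_conn z))) ->
  f =1 h.
Proof.
move=> fB hB fh x; rewrite -[x]reprK.
pose pi0 (D : {freeg (gen g) / int}) : K0 g := \pi_(K0 g)%qT D.
have piB : {morph pi0 : x y / x - y}.
  by move=> a b; exact: K0_piB.
have kB (e : K0 g -> U) : {morph e : x y / x - y} ->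
    {morph (e \o pi0) : x y / x - y} by move=> eB a b; rewrite /= piB eB.
pose F : {additive {freeg (gen g) / int} -> U} :=
  HB.pack (f \o pi0) (GRing.isZmodMorphism.Build _ _ _ (kB _ fB)).
pose H : {additive {freeg (gen g) / int} -> U} :=
  HB.pack (h \o pi0) (GRing.isZmodMorphism.Build _ _ _ (kB _ hB)).
rewrite -/(pi0 _) -[LHS]/(F (repr x)) -[RHS]/(H (repr x)) -(freeg_sumE (repr x)).
rewrite !raddf_sum; apply: eq_bigr => z _.
rewrite -[coeff _ _]intz -freegU_mulz !raddfMz; congr (_ *~ _).
by rewrite /= /pi0 K0_class_gen.
Qed.

Section TensorProducts.
Variables (K : fieldType) (p : nat) (k : divringClosed K) (g : pLieAlg p k).
Implicit Types V W U : conn g.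

Definition tensor_map V V' W W' (f : 'Hom(V, V')) (h : 'Hom(W, W')) :
    'Hom(tensor_conn V W, tensor_conn V' W') :=
  linfun (tensor_lift (fun (v : V) (w : W) => tensor (f v) (h w))).

Lemma tensor_mapE V V' W W' (f : 'Hom(V, V')) (h : 'Hom(W, W')) v w :
  tensor_map f h (tensor v w) = tensor (f v) (h w).
Proof.
rewrite lfunE /= tensor_liftE // => [a v1 v2 w1|a v1 w1 w2].
  by rewrite linearP tensorDl tensorZl.
by rewrite linearP tensorDr tensorZr.
Qed.

Lemma tensor_ind_hom V W U (f : tensor_conn V W -> U) (h : tensor_conn V W -> U) :
  {morph f : x y / x + y} -> {morph h : x y / x + y} ->
  (forall v w, f (tensor v w) = h (tensor v w)) -> f =1 h.
Proof. exact: tensor_ind. Qed.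

Lemma tensor_liftD V W (U : vectType K) (b : V -> W -> U) (x y : tensor_conn V W) :
  tensor_lift b (x + y) = tensor_lift b x + tensor_lift b y.
Proof. by have := tensor_lift_linear b 1 x y; rewrite !scale1r. Qed.
Lemma tensor_liftP V W (U : vectType K) (b : V -> W -> U) a (x y : tensor_conn V W) :
  tensor_lift b (a *: x + y) = a *: tensor_lift b x + tensor_lift b y.
Proof. exact: tensor_lift_linear. Qed.

Lemma tensor_map_conn V V' W W' (f : 'Hom(V, V')) (h : 'Hom(W, W')) :
  @conn_map _ _ _ _ V V' f -> @conn_map _ _ _ _ W W' h -> conn_map (tensor_map f h).
Proof.
move=> fD hD D; apply: (@tensor_ind_hom V W (tensor_conn V' W')
  (fun M => tensor_map f h (conn_nabla (tensor_conn V W) D M))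
  (fun M => conn_nabla (tensor_conn V' W') D (tensor_map f h M))).
- by move=> x y; rewrite nablaD linearD.
- by move=> x y; rewrite linearD nablaD.
move=> v w; rewrite tensor_mapE /= !tensor_nabla_tensor linearD.
by rewrite /= !tensor_mapE fD hD.
Qed.

Lemma tensor_ses V' V V'' W (i : 'Hom(V', V)) (q : 'Hom(V, V'')) :
  @short_exact K p k g V' V V'' i q ->
  short_exact (tensor_map i (\1%VF : 'Hom(W, W)))
              (tensor_map q (\1%VF : 'Hom(W, W))).
Proof.
move=> /short_exact_split[ci cq [r [s [ri qs qi irsq]]]].
have c1 : @conn_map _ _ _ _ W W \1%VF by move=> D v; rewrite !id_lfunE.
apply/short_exact_split; split; [exact: tensor_map_conn|exact: tensor_map_conn|].
exists (tensor_map r (\1%VF : 'Hom(W, W))), (tensor_map s (\1%VF : 'Hom(W, W))).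
split.
- apply: (@tensor_ind_hom V' W (tensor_conn V' W) (fun x => tensor_map r \1%VF (tensor_map i \1%VF x)) id) => //.
    by move=> x y; rewrite !linearD.
  by move=> v w /=; rewrite !tensor_mapE !id_lfunE ri.
- apply: (@tensor_ind_hom V'' W (tensor_conn V'' W) (fun x => tensor_map q \1%VF (tensor_map s \1%VF x)) id) => //.
    by move=> x y; rewrite !linearD.
  by move=> v w /=; rewrite !tensor_mapE !id_lfunE qs.
- apply: (@tensor_ind_hom V' W (tensor_conn V'' W) (fun x => tensor_map q \1%VF (tensor_map i \1%VF x)) (fun=> 0)) => //.
  + by move=> x y; rewrite !linearD.
  + by move=> x y; rewrite addr0.
  by move=> v w /=; rewrite !tensor_mapE !id_lfunE qi tensor0l.
- apply: (@tensor_ind_hom V W (tensor_conn V W) (fun x => tensor_map i \1%VF (tensor_map r \1%VF x) + tensor_map s \1%VF (tensor_map q \1%VF x)) id) => //.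
    by move=> x y; rewrite !linearD addrACA.
  by move=> v w /=; rewrite !tensor_mapE !id_lfunE -tensorDl irsq.
Qed.

(* A bilinear map compatible with the connections induces a map on [V ⊗ W].    *)
Lemma tensor_iso V W U (b : V -> W -> U) (h : U -> tensor_conn V W) :
  (forall a v v' w, b (a *: v + v') w = a *: b v w + b v' w) ->
  (forall a v w w', b v (a *: w + w') = a *: b v w + b v w') ->
  linear h ->
  (forall D v w, conn_nabla U D (b v w) =
     b (conn_nabla V D v) w + b v (conn_nabla W D w)) ->
  (forall v w, h (b v w) = tensor v w) ->
  (forall u, tensor_lift b (h u) = u) ->
  iso (tensor_conn V W) U.
Proof.
move=> bl br hl bD hb bh.
have hD x y : h (x + y) = h x + h y by have := hl 1 x y; rewrite !scale1r.
apply: (@mk_iso K p k g (tensor_conn V W) U (tensor_lift b) h) => //.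
- exact: tensor_lift_linear.
- move=> D; apply: (@tensor_ind_hom V W U
    (fun M => tensor_lift b (conn_nabla (tensor_conn V W) D M))
    (fun M => conn_nabla U D (tensor_lift b M))).
  + by move=> x y; rewrite nablaD linearD.
  + by move=> x y; rewrite linearD nablaD.
  move=> v w /=; rewrite /= tensor_nabla_tensor linearD.
  by rewrite /= !tensor_liftE ?bD.
- apply: (@tensor_ind_hom V W (tensor_conn V W) (fun M => h (tensor_lift b M)) id) => //.
    by move=> x y; rewrite linearD hD.
  by move=> v w /=; rewrite tensor_liftE.
Qed.

Lemma tensor_isoC V W : iso (tensor_conn V W) (tensor_conn W V).
Proof.
apply: (@tensor_iso V W (tensor_conn W V) (fun v w => tensor w v)
  (tensor_lift (fun w v => tensor v w))).
- by move=> a v v' w; rewrite tensorDr tensorZr.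
- by move=> a v w w'; rewrite tensorDl tensorZl.
- exact: tensor_lift_linear.
- by move=> D v w; rewrite /= tensor_nabla_tensor addrC.
- move=> v w /=; rewrite tensor_liftE // => [a v' v'' w'|a v' v'' w'].
    by rewrite tensorDr tensorZr.
  by rewrite tensorDl tensorZl.
- apply: (@tensor_ind_hom W V (tensor_conn W V) (fun M => tensor_lift (fun v w => tensor w v)
     (tensor_lift (fun w v => tensor v w) M)) id) => //.
    by move=> x y; rewrite !tensor_liftD.
  move=> v w /=; rewrite !tensor_liftE // => *;
    by rewrite ?(tensorDl, tensorZl) ?(tensorDr, tensorZr).
Qed.

Lemma tensor_iso1 V : iso (tensor_conn (theta g) V) V.
Proof.
apply: (@tensor_iso (theta g) V V (fun (a : K^o) v => a *: v)
  (fun v => tensor (1 : theta g) v)).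
- by move=> a v v' w; rewrite scalerDl scalerA.
- by move=> a v w w'; rewrite scalerDr !scalerA mulrC.
- by move=> a v w; rewrite tensorDr tensorZr.
- by move=> D a v; rewrite nabla_Leibniz addrC.
- by move=> a v; rewrite tensorZr -tensorZl /= [_ *: _]mulr1.
- move=> v; rewrite tensor_liftE ?scale1r // => [a b c w|a b w w'].
    by rewrite scalerDl scalerA.
  by rewrite scalerDr !scalerA mulrC.
Qed.

Lemma tensor_isoA V W U :
  iso (tensor_conn (tensor_conn V W) U) (tensor_conn V (tensor_conn W U)).
Proof.
pose c (u : U) : V -> W -> tensor_conn V (tensor_conn W U) :=
  fun v w => tensor v (tensor w u : tensor_conn W U).
have cl u a v v' w : c u (a *: v + v') w = a *: c u v w + c u v' w.
  by rewrite /c tensorDl tensorZl.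
have cr u a v w w' : c u v (a *: w + w') = a *: c u v w + c u v w'.
  by rewrite /c tensorDl tensorZl tensorDr tensorZr.
pose d (v : V) : W -> U -> tensor_conn (tensor_conn V W) U :=
  fun w u => tensor (tensor v w : tensor_conn V W) u.
have dl v a w w' u : d v (a *: w + w') u = a *: d v w u + d v w' u.
  by rewrite /d tensorDr tensorZr tensorDl tensorZl.
have dr v a w u u' : d v w (a *: u + u') = a *: d v w u + d v w u'.
  by rewrite /d tensorDr tensorZr.
pose b (M : tensor_conn V W) u : tensor_conn V (tensor_conn W U) := tensor_lift (c u) M.
pose e v (M : tensor_conn W U) : tensor_conn (tensor_conn V W) U := tensor_lift (d v) M.
have bl a v v' w : b (a *: v + v') w = a *: b v w + b v' w.
  by rewrite /b tensor_liftP.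
have br a v w w' : b v (a *: w + w') = a *: b v w + b v w'.
  move: v; apply: (@tensor_ind_hom V W _ (fun v => b v (a *: w + w'))
    (fun v => a *: b v w + b v w')).
  - by move=> x y; rewrite /b tensor_liftD.
  - by move=> x y; rewrite /b !tensor_liftD scalerDr addrACA.
  move=> x y; rewrite /b !tensor_liftE //.
  by rewrite /c !(tensorDr, tensorZr).
have er a v w w' : e v (a *: w + w') = a *: e v w + e v w'.
  by rewrite /e tensor_liftP.
have el a v v' w : e (a *: v + v') w = a *: e v w + e v' w.
  move: w; apply: (@tensor_ind_hom W U _ (fun w => e (a *: v + v') w)
    (fun w => a *: e v w + e v' w)).
  - by move=> x y; rewrite /e tensor_liftD.
  - by move=> x y; rewrite /e !tensor_liftD scalerDr addrACA.
  move=> x y; rewrite /e !tensor_liftE //.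
  by rewrite /d !(tensorDl, tensorZl).
have bt v w u : b (tensor v w) u = tensor v (tensor w u : tensor_conn W U).
  by rewrite /b tensor_liftE.
have et v w u : e v (tensor w u) = tensor (tensor v w : tensor_conn V W) u.
  by rewrite /e tensor_liftE.
have bDl u x y : b (x + y) u = b x u + b y u.
  by have := bl 1 x y u; rewrite !scale1r.
have bDr x u u' : b x (u + u') = b x u + b x u'.
  by have := br 1 x u u'; rewrite !scale1r.
apply: (@tensor_iso (tensor_conn V W) U (tensor_conn V (tensor_conn W U)) b
  (tensor_lift e)) => //.
- exact: tensor_lift_linear.
- move=> D v u; move: v.
  apply: (@tensor_ind_hom V W (tensor_conn V (tensor_conn W U))
    (fun v => conn_nabla (tensor_conn V (tensor_conn W U)) D (b v u))
    (fun v => b (conn_nabla (tensor_conn V W) D v) u + b v (conn_nabla U D u))).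
  + by move=> x y; rewrite bDl nablaD.
  + by move=> x y; rewrite nablaD !bDl addrACA.
  move=> v w /=; rewrite bt /= !tensor_nabla_tensor /= tensor_nabla_tensor bDl !bt.
  by rewrite tensorDr addrA.
- move=> v u; move: v.
  apply: (@tensor_ind_hom V W (tensor_conn (tensor_conn V W) U)
    (fun v => tensor_lift e (b v u)) (fun v => tensor v u)).
  + by move=> x y; rewrite bDl tensor_liftD.
  + by move=> x y; rewrite tensorDl.
  by move=> v w /=; rewrite bt tensor_liftE // et.
apply: (@tensor_ind_hom V (tensor_conn W U) (tensor_conn V (tensor_conn W U))
  (fun M => tensor_lift b (tensor_lift e M)) id) => //.
  by move=> x y; rewrite !tensor_liftD.
move=> v w /=; rewrite tensor_liftE //; move: w.
apply: (@tensor_ind_hom W U (tensor_conn V (tensor_conn W U))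
  (fun M => tensor_lift b (e v M)) (fun M => tensor v M)).
- by move=> x y; rewrite /e !tensor_liftD.
- by move=> x y; rewrite tensorDr.
by move=> w u; rewrite et tensor_liftE // bt.
Qed.

End TensorProducts.

Section GrothendieckRing.
Variables (K : fieldType) (p : nat) (k : divringClosed K) (g : pLieAlg p k).
Implicit Types (V W U : conn g) (x y z : K0 g).

Definition K0_mul x y : K0 g :=
  K0_lift (fun v => K0_lift (fun w => K0_class (tensor_conn (gen_conn v) (gen_conn w))) y) x.

Lemma iso_tensor V V' W W' :
  iso V V' -> iso W W' -> iso (tensor_conn V W) (tensor_conn V' W').
Proof.
have isol V1 V2 V3 : iso V1 V2 -> iso (tensor_conn V1 V3) (tensor_conn V2 V3).
  case=> f [h [fD hf fh]].
  exists (tensor_map f (\1%VF : 'Hom(V3, V3))), (tensor_map h (\1%VF : 'Hom(V3, V3))).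
  split.
  - by apply: tensor_map_conn => // D v; rewrite !id_lfunE.
  - apply: (@tensor_ind_hom K p k g V1 V3 (tensor_conn V1 V3) (fun m => tensor_map h \1%VF (tensor_map f \1%VF m)) id) => //.
      by move=> m n; rewrite !linearD.
    by move=> v w; rewrite !tensor_mapE !id_lfunE hf.
  - apply: (@tensor_ind_hom K p k g V2 V3 (tensor_conn V2 V3) (fun m => tensor_map f \1%VF (tensor_map h \1%VF m)) id) => //.
      by move=> m n; rewrite !linearD.
    by move=> v w; rewrite !tensor_mapE !id_lfunE fh.
move=> /isol i1 /isol i2; apply: (iso_trans (i1 _)).
apply: (iso_trans (tensor_isoC _ _)); apply: (iso_trans (i2 _)).
exact: tensor_isoC.
Qed.

Lemma ses_additive_tensor_l W :
  ses_additive (fun v : gen g => K0_class (tensor_conn (gen_conn v) W)).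
Proof. by move=> x' x x'' i q /(tensor_ses W)/K0_class_ses. Qed.

Lemma ses_additive_tensor_r V :
  ses_additive (fun w : gen g => K0_class (tensor_conn V (gen_conn w))).
Proof.
move=> x' x x'' i q /ses_additive_tensor_l-/(_ V).
by rewrite !(K0_class_iso (tensor_isoC _ V)).
Qed.

Lemma ses_additive_mul y : ses_additive (fun v : gen g =>
  K0_lift (fun w => K0_class (tensor_conn (gen_conn v) (gen_conn w))) y).
Proof.
move=> x' x x'' i q ses; rewrite /K0_lift /freeg_lift -big_split.
apply: eq_bigr => w _ /=; rewrite -mulrzDl; congr (_ *~ _).
exact: ses_additive_tensor_l ses.
Qed.

Lemma K0_mulBl x y z : K0_mul (x - y) z = K0_mul x z - K0_mul y z.
Proof. exact: (K0_liftB (ses_additive_mul z)). Qed.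

Lemma K0_mulBr x y z : K0_mul x (y - z) = K0_mul x y - K0_mul x z.
Proof.
rewrite /K0_mul /K0_lift /freeg_lift -sumrB; apply: eq_bigr => v _.
rewrite -mulrzBl; congr (_ *~ _).
exact: (K0_liftB (@ses_additive_tensor_r (gen_conn v))).
Qed.

Lemma K0_lift_class (U : zmodType) (phi : gen g -> U) v : ses_additive phi ->
  K0_lift phi (K0_class (gen_conn v)) = phi v.
Proof. by move=> h; rewrite -K0_class_gen K0_lift_gen. Qed.

Lemma K0_class_tensor V W : K0_mul (K0_class V) (K0_class W) = K0_class (tensor_conn V W).
Proof.
rewrite (K0_class_iso (iso_gen_of V)) (K0_class_iso (iso_gen_of W)).
rewrite /K0_mul (K0_lift_class _ (ses_additive_mul _)).
rewrite (K0_lift_class _ (@ses_additive_tensor_r _)).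
by apply: K0_class_iso; apply: iso_tensor; apply/iso_sym/iso_gen_of.
Qed.

Lemma K0_mulC : commutative K0_mul.
Proof.
move=> x y; move: x; apply: K0_ext => [a b|a b|v]; [exact: K0_mulBl|exact: K0_mulBr|].
move: y; apply: K0_ext => [a b|a b|w]; [exact: K0_mulBr|exact: K0_mulBl|].
by rewrite !K0_class_tensor; apply/K0_class_iso/tensor_isoC.
Qed.

Lemma K0_mulA : associative K0_mul.
Proof.
move=> x y z; move: x; apply: K0_ext => [a b|a b|v]; rewrite ?K0_mulBl //.
move: y; apply: K0_ext => [a b|a b|w]; rewrite ?(K0_mulBl, K0_mulBr) //.
move: z; apply: K0_ext => [a b|a b|u]; rewrite ?(K0_mulBl, K0_mulBr) //.
by rewrite !K0_class_tensor; apply/esym/K0_class_iso/tensor_isoA.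
Qed.

Lemma K0_mul1 : left_id (K0_class (theta g)) K0_mul.
Proof.
apply: K0_ext => [a b|a b|v]; rewrite ?K0_mulBr //.
by rewrite K0_class_tensor; apply/K0_class_iso/tensor_iso1.
Qed.

Lemma K0_mulDl : left_distributive K0_mul +%R.
Proof.
move=> x y z; have m0 : K0_mul 0 z = 0 by rewrite -[X in K0_mul X z](subrr 0) K0_mulBl subrr.
by rewrite -{1}[y]opprK K0_mulBl -[- y]sub0r K0_mulBl m0 sub0r opprK.
Qed.

(* [e(x) = \sum_i n_i \dim V_i].                                               *)
Definition K0_rank x : int := K0_lift (fun v => (\dim {: gen_conn v})%:Z) x.

Lemma ses_additive_rank :
  ses_additive (fun v : gen g => (\dim {: gen_conn v})%:Z).
Proof.
move=> x' x x'' i q [_ _ i0 iq q1]; rewrite -PoszD.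
rewrite -(limg_ker_dim q {: gen_conn x}) q1 capfv -iq.
by rewrite -(limg_ker_dim i {: gen_conn x'}) i0 capv0 dimv0 add0n.
Qed.

Lemma iso_dim V W : iso V W -> \dim {: V} = \dim {: W}.
Proof.
case=> f [h [_ hf fh]].
have kf : lker f == 0%VS by apply/lker0P => x y e; rewrite -(hf x) e hf.
rewrite -(limg_dim_eq (f := f)) ?(eqP kf) ?capv0 //; congr (\dim _).
apply/eqP; rewrite eqEsubv subvf; apply/subvP => x _.
by rewrite -(fh x) memv_img ?memvf.
Qed.

Lemma K0_rank_class V : K0_rank (K0_class V) = \dim {: V}.
Proof.
rewrite (K0_class_iso (iso_gen_of V)) /K0_rank (K0_lift_class _ ses_additive_rank).
by rewrite (iso_dim (iso_gen_of V)).
Qed.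

Lemma K0_one_neq0 : K0_class (theta g) != 0.
Proof.
apply/eqP => e; have := K0_rank_class (theta g); rewrite e.
have := K0_liftB ses_additive_rank 0 0; rewrite subr0 -/(K0_rank 0) => ->.
by rewrite subrr dimvf.
Qed.

HB.instance Definition _ := GRing.Zmodule_isComNzRing.Build (K0 g)
  K0_mulA K0_mulC K0_mul1 K0_mulDl K0_one_neq0.

End GrothendieckRing.

Section Restriction.
Variables (K : fieldType) (p : nat) (k : divringClosed K).
Variables (h g : pLieAlg p k).

(* The morphisms of [Lie_{K/k}].                                               *)
Definition lie_incl : Prop := forall D, h D -> g D.

Variable F : lie_incl.

Definition elt_incl (D : pLie_elt h) : pLie_elt g :=
  exist _ (D : K -> K) (F (svalP D)).

Program Definition res_conn (V : conn g) : conn h :=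
  @Conn K p k h V (@mk_connection K p k h V
    (fun D v => conn_nabla V (elt_incl D) v) _ _ _).
Next Obligation. exact: nablaD. Qed.
Next Obligation.
rewrite -nabla_comb; congr (conn_nabla V _ v).
by congr exist; exact: Prop_irrelevance.
Qed.
Next Obligation. exact: nabla_Leibniz. Qed.

Definition K0_res (x : K0 g) : K0 h :=
  K0_lift (fun v => K0_class (res_conn (gen_conn v))) x.

Lemma ses_additive_res :
  ses_additive (fun v : gen g => K0_class (res_conn (gen_conn v))).
Proof.
move=> x' x x'' i q [ci cq i0 iq q1].
apply: (@K0_class_ses _ _ _ _ (res_conn (gen_conn x')) (res_conn (gen_conn x))
  (res_conn (gen_conn x'')) i q).
by split=> // D v; [apply: ci | apply: cq].
Qed.

Lemma K0_res_class (V : conn g) : K0_res (K0_class V) = K0_class (res_conn V).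
Proof.
rewrite (K0_class_iso (iso_gen_of V)) /K0_res (K0_lift_class _ ses_additive_res).
apply/esym/K0_class_iso; have [f [f' [fD ff' f'f]]] := iso_gen_of V.
by exists f, f'; split=> // D v; apply: fD.
Qed.

End Restriction.

Section ExteriorPowers.
Variables (K : fieldType) (p : nat) (k : divringClosed K) (g : pLieAlg p k).
Variables (l : nat) (V : conn g).
Implicit Types (v : 'I_l -> V) (D : pLie_elt g).

Definition incr (n : nat) :=
  {s : {ffun 'I_l -> 'I_n} | [forall i : 'I_l, forall j : 'I_l, (i < j)%N ==> (s i < s j)%N]}.

(* Coordinates with respect to the basis [e_(s 0) ∧ ... ∧ e_(s (l-1))], for    *)
(* [s] strictly increasing.                                                    *)
Definition ext_space : vectType K := {ffun incr (dim V) -> K^o}.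

(* [v_0 ∧ ... ∧ v_(l-1)]: its coordinates are the maximal minors.              *)
Definition wedge v : ext_space :=
  [ffun s : incr (dim V) => \det (\matrix_(i, j) v2r (v i) 0 (val s j)) : K^o].

Definition upd v (i : 'I_l) (x : V) : 'I_l -> V :=
  fun j => if j == i then x else v j.

(* The Leibniz rule in coordinates; see [ext_nabla_wedge].                     *)
Definition ext_nabla D (a : ext_space) : ext_space :=
  \sum_s (D (a s) *: wedge (fun i => basis (val s i)) +
     a s *: \sum_i wedge (upd (fun j => basis (val s j)) i
                              (conn_nabla V D (basis (val s i))))).

Lemma incr_inj n (s : incr n) : injective (val s).
Proof.
case: s => s /= /forallP s_incr i j e; apply/val_inj/eqP.
case: ltngtP => // ij.
- by have /forallP/(_ j)/implyP/(_ ij) := s_incr i; rewrite e ltnn.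
- by have /forallP/(_ i)/implyP/(_ ij) := s_incr j; rewrite e ltnn.
Qed.

Lemma incr_lt n (s : incr n) (i j : 'I_l) : (i < j)%N -> (val s i < val s j)%N.
Proof. by case: s => s /= /forallP/(_ i)/forallP/(_ j)/implyP. Qed.

Lemma incr_codom n (s t : incr n) :
  (forall i, exists j, val s i = val t j) -> s = t.
Proof.
move=> st; apply/val_inj/ffunP.
have sub : {subset codom (val s) <= codom (val t)}.
  by move=> _ /codomP[i ->]; have [j ->] := st i; apply: codom_f.
have srt (u : incr n) : sorted ltn (map val (codom (val u))).
  rewrite (sorted_pairwise ltn_trans) pairwise_map codomE.
  rewrite pairwise_map; apply: (@sub_in_pairwise _ predT (relpre val ltn)) => //.
    by move=> i j _ _ /= /(incr_lt u).
  by apply/all_predT.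
  by rewrite -pairwise_map val_enum_ord -(sorted_pairwise ltn_trans) iota_ltn_sorted.
have eqc : codom (val s) = codom (val t).
  apply: (inj_map val_inj); apply: (irr_sorted_eq ltn_trans ltnn) => // x.
  have us : uniq (codom (val s)) by apply/injectiveP/incr_inj.
  have [|_ E] := uniq_min_size us sub; first by rewrite !size_codom.
  by apply/mapP/mapP => -[y yc ->]; exists y; rewrite // ?E // -E.
move=> i; have := congr1 (fun c => nth (val s i) c i) eqc.
have E (u : incr n) : nth (val s i) (codom (val u)) i = val u i.
  by rewrite codomE (nth_map i) ?size_enum_ord // nth_ord_enum.
by rewrite !E.
Qed.

Lemma wedge_basis (s t : incr (dim V)) :
  wedge (fun i => basis (val s i)) t = (s == t)%:R.
Proof.
rewrite ffunE; have [<-|st] := eqVneq.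
  rewrite (_ : \matrix_(i, j) _ = 1%:M) ?det1 //; apply/matrixP => i j.
  by rewrite !mxE /basis r2vK mxE eqxx /= (inj_eq (@incr_inj _ s)) eq_sym.
have /existsP[i /forallP ni] : [exists i, forall j, val s i != val t j].
  apply: contraNT st; rewrite negb_exists => /forallP st.
  apply/eqP/incr_codom => i; have := st i; rewrite negb_forall.
  by move=> /existsP[j]; rewrite negbK => /eqP; exists j.
rewrite (expand_det_row _ i) big1 // => j _.
by rewrite mxE /basis r2vK mxE eqxx /= eq_sym (negPf (ni j)) mul0r.
Qed.

Lemma ext_sumE (a : ext_space) :
  a = \sum_s a s *: wedge (fun i => basis (val s i)).
Proof.
apply/ffunP => t; rewrite sum_ffunE.
have Z s : (a s *: wedge (fun i => basis (val s i)) : ext_space) t =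
    a s * (s == t)%:R by rewrite ffunE wedge_basis.
under eq_bigr do rewrite Z.
by rewrite (bigD1 t) //= eqxx mulr1 big1 ?addr0 // => s /negPf->; rewrite mulr0.
Qed.

Lemma ext_nablaD D (a b : ext_space) :
  ext_nabla D (a + b) = ext_nabla D a + ext_nabla D b.
Proof.
rewrite -big_split; apply: eq_bigr => s _ /=.
by rewrite ffunE eltD !scalerDl addrACA.
Qed.

Lemma ext_nabla_Leibniz D c (a : ext_space) :
  ext_nabla D (c *: a) = c *: ext_nabla D a + D c *: a.
Proof.
rewrite [in X in _ + X](ext_sumE a) !scaler_sumr -big_split.
apply: eq_bigr => s _ /=; rewrite ffunE eltM !scalerDl !scalerDr !scalerA.
by rewrite -!addrA [LHS]addrC -!addrA.
Qed.

Lemma wedge_lin v i c x y :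
  wedge (upd v i (c *: x + y)) = c *: wedge (upd v i x) + wedge (upd v i y).
Proof.
apply/ffunP => s; rewrite !ffunE.
rewrite (@determinant_multilinear _ _ _
  (\matrix_(a, b) v2r (upd v i x a) 0 (val s b))
  (\matrix_(a, b) v2r (upd v i y a) 0 (val s b)) i c 1).
- by rewrite mul1r.
- by apply/rowP => b; rewrite !mxE /upd eqxx linearP !mxE mul1r.
- by apply/matrixP => a b; rewrite !mxE /upd eq_sym (negPf (neq_lift _ _)).
- by apply/matrixP => a b; rewrite !mxE /upd eq_sym (negPf (neq_lift _ _)).
Qed.

Lemma wedge_alt v i j : i != j -> v i = v j -> wedge v = 0.
Proof.
move=> ij vij; apply/ffunP => s; rewrite !ffunE.
by apply: (determinant_alternate ij) => b; rewrite !mxE vij.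
Qed.

Lemma ext_nabla_comb a D1 D2 (x : ext_space) :
  ext_nabla (elt_comb a D1 D2) x = a *: ext_nabla D1 x + ext_nabla D2 x.
Proof.
rewrite scaler_sumr -big_split; apply: eq_bigr => s _ /=.
under eq_bigr do rewrite nabla_comb wedge_lin.
rewrite big_split -scaler_sumr /= !scalerDl !scalerDr !scalerA.
by rewrite [x s * a]mulrC addrACA.
Qed.

Definition ext_conn : conn g :=
  Conn (mk_connection ext_nablaD ext_nabla_comb ext_nabla_Leibniz).

End ExteriorPowers.

Section ExteriorLeibniz.
Variables (K : fieldType) (p : nat) (k : divringClosed K) (g : pLieAlg p k).
Variables (l : nat) (V : conn g).
Implicit Types (v : 'I_l -> V) (D : pLie_elt g).

Lemma updE v i : upd v i (v i) = v.
Proof. by apply/funext => j; rewrite /upd; case: eqP => // ->. Qed.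

Lemma upd_upd v i x y : upd (upd v i x) i y = upd v i y.
Proof. by apply/funext => j; rewrite /upd; case: eqP. Qed.

Lemma updC v i j x y : i != j -> upd (upd v i x) j y = upd (upd v j y) i x.
Proof.
move=> ij; apply/funext => a; rewrite /upd.
by case: (a =P j) => // ->; rewrite eq_sym (negPf ij).
Qed.

Lemma upd_same v i x : upd v i x i = x.
Proof. by rewrite /upd eqxx. Qed.
Lemma upd_other v i j x : j != i -> upd v i x j = v j.
Proof. by rewrite /upd => /negPf->. Qed.

Section Alternating.
Variables (U : lmodType K) (Phi : ('I_l -> V) -> U).
Hypothesis Phi_lin : forall v i c x y,
  Phi (upd v i (c *: x + y)) = c *: Phi (upd v i x) + Phi (upd v i y).
Hypothesis Phi_alt : forall v i j, i != j -> v i = v j -> Phi v = 0.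
Hypothesis Phi_basis : forall s : incr l (dim V), Phi (fun i => basis (val s i)) = 0.

Lemma Phi_tperm v i j : i != j -> Phi (v \o tperm i j) = - Phi v.
Proof.
move=> ij; have PD u a x y : Phi (upd u a (x + y)) = Phi (upd u a x) + Phi (upd u a y).
  by rewrite -[x]scale1r Phi_lin !scale1r.
pose w x y := Phi (upd (upd v i x) j y).
have w0 x : w x x = 0.
  apply: (@Phi_alt _ i j) => //.
  by rewrite upd_same upd_other // upd_same.
have wDl x y z : w (x + y) z = w x z + w y z.
  by rewrite /w !(@updC _ i j) // PD.
have wDr x y z : w z (x + y) = w z x + w z y by rewrite /w PD.
have := w0 (v i + v j); rewrite wDl !wDr !w0 add0r addr0 => /eqP.
rewrite addrC addr_eq0 => /eqP e; move: e; rewrite /w.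
rewrite (_ : upd (upd v i (v i)) j (v j) = v) ?updE //.
rewrite (_ : upd _ _ _ = v \o tperm i j) //; apply/funext => a; rewrite /upd /=.
by case: tpermP => [->|->|/eqP/negPf-> /eqP/negPf->//]; rewrite ?eqxx // (negPf ij).
Qed.

Lemma Phi_perm v (s : 'S_l) : Phi v = 0 -> Phi (v \o s) = 0.
Proof.
move=> v0; have [ts -> /allP dts] := prod_tpermP s.
elim: ts v v0 dts => [|[a b] ts IH] v v0 dts.
  by rewrite big_nil (_ : v \o _ = v) //; apply/funext => i; rewrite /= perm1.
have ab : a != b := dts (a, b) (mem_head _ _).
rewrite big_cons (_ : v \o _ = (v \o \prod_(t <- ts) tperm t.1 t.2)%g \o tperm a b).
  rewrite Phi_tperm // IH ?oppr0 // => t tts; apply: dts.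
  by rewrite inE tts orbT.
by apply/funext => i; rewrite /= permM.
Qed.

Lemma Phi_basis0 (f : 'I_l -> 'I_(dim V)) : Phi (fun i => basis (f i)) = 0.
Proof.
have [/injectiveP finj|/injectivePn[i [j ij fij]]] := boolP (injectiveb f); last first.
  by apply: (Phi_alt ij); rewrite fij.
pose r := relpre (val : 'I_(dim V) -> nat) leq.
have rtot : total r by move=> a b; apply: leq_total.
pose tf := [tuple f i | i < l]; pose ts := sort_tuple r tf.
have /tuple_permP[s ets] : perm_eq ts tf by rewrite perm_sort.
have tsE i : tnth ts i = f (s i).
  by rewrite (tnth_nth (f i)) ets nth_mktuple tnth_mktuple.
have tsrt : sorted ltn (map val ts).
  rewrite ltn_sorted_uniq_leq (map_inj_uniq val_inj) sort_uniq; apply/andP; split.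
    by apply/tuple_uniqP => i j; rewrite !tnth_mktuple => /finj.
  by rewrite sorted_map; apply: sort_sorted.
have tincr : [forall i : 'I_l, forall j : 'I_l,
    (i < j)%N ==> ([ffun i => tnth ts i] i < [ffun i => tnth ts i] j)%N].
  apply/forallP => i; apply/forallP => j; apply/implyP => ij; rewrite !ffunE.
  rewrite !(tnth_nth (f i)) -!(nth_map _ 0%N val) ?size_tuple //.
  by apply: (sorted_ltn_nth ltn_trans) => //; rewrite inE size_map size_tuple.
pose si : incr l (dim V) := exist _ [ffun i => tnth ts i] tincr.
have := Phi_perm (s^-1)%g (Phi_basis si).
rewrite (_ : _ \o _ = fun i => basis (f i)) //; apply/funext => i /=.
by rewrite ffunE tsE permKV.
Qed.

Lemma Phi_eq0 v : Phi v = 0.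
Proof.
have P0 u i : Phi (upd u i 0) = 0.
  by apply: (addrI (Phi (upd u i 0))); have := Phi_lin u i 1 0 0;
     rewrite scaler0 addr0 scale1r => <-; rewrite addr0.
have PD u a x y : Phi (upd u a (x + y)) = Phi (upd u a x) + Phi (upd u a y).
  by rewrite -[x]scale1r Phi_lin !scale1r.
have PZ u a c x : Phi (upd u a (c *: x)) = c *: Phi (upd u a x).
  by rewrite -[c *: x]addr0 Phi_lin P0 addr0.
suff H (m : nat) : forall v, (forall i : 'I_l, (m <= i)%N -> exists j, v i = basis j) ->
    Phi v = 0 by apply: (H l) => i; rewrite leqNgt ltn_ord.
elim: m => [|m IH] {}v hv.
  have /choice[f fE] : forall i, exists j, v i = basis j by move=> i; apply: hv.
  by rewrite (_ : v = fun i => basis (f i)) ?Phi_basis0 //; apply/funext.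
have [ml|lm] := ltnP m l; last first.
  by apply: IH => i mi; have := leq_trans lm mi; rewrite leqNgt ltn_ord.
pose i0 := Ordinal ml; rewrite -(updE v i0) (basis_sum (v i0)).
rewrite (big_morph (fun x => Phi (upd v i0 x)) (PD v i0) (P0 v i0)) big1 // => j _.
rewrite PZ IH ?scaler0 // => i mi; have [->|ii0] := eqVneq i i0.
  by exists j; rewrite upd_same.
rewrite upd_other //; apply: hv; rewrite ltn_neqAle mi andbT.
by apply: contraNneq ii0 => e; apply/eqP/val_inj.
Qed.

End Alternating.

Lemma ext_nabla_wedge D v :
  ext_nabla D (wedge v) = \sum_i wedge (upd v i (conn_nabla V D (v i))).
Proof.
pose Phi u : ext_space l V := ext_nabla D (wedge u) -
  \sum_i wedge (upd u i (conn_nabla V D (u i))).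
apply/eqP; rewrite -subr_eq0; apply/eqP; apply: (@Phi_eq0 _ Phi) => {v}.
- move=> v i c x y; rewrite /Phi wedge_lin ext_nablaD ext_nabla_Leibniz.
  have E z : \sum_a wedge (upd (upd v i z) a (conn_nabla V D (upd v i z a))) =
      wedge (upd v i (conn_nabla V D z)) +
      \sum_(a | a != i) wedge (upd (upd v a (conn_nabla V D (v a))) i z).
    rewrite (bigD1 i) //= upd_same upd_upd; congr (_ + _).
    by apply: eq_bigr => a ai; rewrite upd_other // updC 1?eq_sym.
  rewrite !E nablaD nabla_Leibniz.
  under eq_bigr do rewrite wedge_lin.
  rewrite big_split -scaler_sumr /= -[_ + _ + conn_nabla V D y]addrA wedge_lin.
  rewrite -[conn_nabla V D y]scale1r wedge_lin !scale1r.
  move: (ext_nabla _ _) (ext_nabla _ _) => M N; apply/ffunP => s.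
  rewrite !(sum_ffunE, ffunE) /= /GRing.scale /=; ring.
- move=> v i j ij vij; rewrite /Phi (wedge_alt ij vij).
  rewrite -[X in ext_nabla D X](scale0r 0) ext_nabla_Leibniz elt0 !scale0r addr0 sub0r.
  rewrite (bigD1 i) // (bigD1 j) 1?eq_sym //= big1 ?addr0; last first.
    move=> a /andP[ai aj]; apply: (wedge_alt ij).
    by rewrite !upd_other // eq_sym.
  set z := conn_nabla V D (v i); rewrite -vij -/z.
  have W0 : wedge (upd (upd v i (v i + z)) j (v i + z)) = 0.
    by apply: (wedge_alt ij); rewrite upd_same upd_other // upd_same.
  have WD u a x y : wedge (upd u a (x + y)) = wedge (upd u a x) + wedge (upd u a y).
    by rewrite -[x]scale1r wedge_lin !scale1r.
  move: W0; rewrite WD ![upd (upd v i _) j _]updC // !WD.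
  have Z x : wedge (upd (upd v j x) i x) = 0.
    by apply: (wedge_alt ij); rewrite upd_same upd_other 1?eq_sym // upd_same.
  rewrite !Z add0r addr0.
  rewrite [X in upd (upd v j X)]vij updE -[upd (upd v j z) i _]updC // updE.
  by rewrite addrC => ->; rewrite oppr0.
- move=> s; rewrite /Phi {1}/ext_nabla (bigD1 s) //= [X in _ + X - _]big1 ?addr0.
    by rewrite wedge_basis eqxx elt1 scale0r add0r scale1r subrr.
  by move=> t /negPf ts; rewrite wedge_basis eq_sym ts elt0 !scale0r addr0.
Qed.

End ExteriorLeibniz.

(* Power series over [R] as coefficient sequences.                             *)
Section PowerSeries.
Variable R : comNzRingType.
Implicit Types f h : nat -> R.

Definition fps_one : nat -> R := fun n => (n == 0)%:R.
Definition fps_X : nat -> R := fun n => (n == 1)%:R.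
Definition fps_sub f h : nat -> R := fun n => f n - h n.
Definition fps_mul f h : nat -> R :=
  fun n => \sum_(i < n.+1) f i * h (n - i)%N.
Definition fps_exp f (m : nat) : nat -> R := iter m (fps_mul f) fps_one.

(* [\sum_m f_m h^m] for [h] without constant term: [h^m] does not contribute   *)
(* to the coefficient of [t^n] when [n < m].                                   *)
Definition fps_comp f h : nat -> R :=
  fun n => \sum_(m < n.+1) f m * fps_exp h m n.

(* The inverse of [f] with constant term 1: the geometric series in [1 - f].   *)
Definition fps_inv f : nat -> R := fps_comp (fun=> 1) (fps_sub fps_one f).

Definition fps_expz f (m : int) : nat -> R :=
  match m with
  | Posz n => fps_exp f n
  | Negz n => fps_exp (fps_inv f) n.+1
  end.

(* [u = t / (1 - t)] *)
Definition fps_u : nat -> R := fps_mul fps_X (fps_inv (fps_sub fps_one fps_X)).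

End PowerSeries.

Section ChernClasses.
Variables (K : fieldType) (p : nat) (k : divringClosed K) (g : pLieAlg p k).
Implicit Types (x : K0 g).

Definition ext_series (V : conn g) : nat -> K0 g :=
  fun l => K0_class (ext_conn l V).

(* [lambda_t(\sum_i n_i [V_i]) = \prod_i (\sum_l [∧^l V_i] t^l)^{n_i}]; this   *)
(* does not depend on the choice of the representative [repr x], because the   *)
(* series of exterior powers is multiplicative on short exact sequences.       *)
Definition lambda_t x : nat -> K0 g :=
  \big[@fps_mul (K0 g) / @fps_one (K0 g)]_(z <- dom (repr x))
     fps_expz (ext_series (gen_conn z)) (coeff z (repr x)).

Definition lambda (l : nat) x : K0 g := lambda_t x l.

Definition gamma_t x : nat -> K0 g := fps_comp (lambda_t x) (@fps_u (K0 g)).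

Definition gamma (l : nat) x : K0 g := gamma_t x l.

Definition K0_d x : K0 g := K0_class (theta g) *~ K0_rank x.

Definition chern (l : nat) x : K0 g := (-1) ^+ l * gamma l (x - K0_d x).

Definition effective x : Prop :=
  exists (m : nat) (n : 'I_m -> nat) (V : 'I_m -> conn g),
    (forall i, 0 < n i)%N /\ x = \sum_i K0_class (V i) *+ n i.

End ChernClasses.

(* Main.v *)
Require Import Defs.
From HB Require Import structures.
From mathcomp Require Import all_boot all_order all_algebra.
From mathcomp Require Import fingroup perm boolp ring zify.

(* The crux is that [V |-> \sum_l [∧^l V] t^l] is multiplicative on short     *)
(* exact sequences [0 -> V' -> V -> V'' -> 0]. Up to isomorphism [V] is        *)
(* [V' ⊕ V''] with a block triangular connection; the span of the wedges with  *)
(* at least [m] factors in [V'] is then stable in [∧^l V], and the [m]-th      *)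
(* graded piece of this filtration is [∧^m V' ⊗ ∧^(l-m) V'']. Hence            *)
(* [lambda_t], and [gamma_t = lambda_u], turn sums into products, which gives  *)
(* (1). For (2), additivity reduces to a single connection [V] of dimension    *)
(* [e], where [gamma_t([V] - e) = \sum_(m <= e) [∧^m V] t^m (1 - t)^(e - m)]   *)
(* is a polynomial of degree at most [e]. For (3), restriction is a ring       *)
(* morphism that preserves exterior powers and ranks.                          *)

Set Implicit Arguments.
Unset Strict Implicit.
Unset Printing Implicit Defensive.

Import GRing.Theory VectorInternalTheory.
Local Open Scope ring_scope.

(** * Power series *)

(** A short exact sequence of connections splits only [K]-linearly. The off-diagonal part of the
    middle connection maps the quotient into the sub, so it raises the number of wedge factors in
    the sub and vanishes on graded pieces ([nabla_block_mul]). As [K_0] sees only graded pieces,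
    [K0_class_filtration] and [iso_block_piece] give [ext_series_block], which [ext_series_ses]
    carries over to any exact sequence along a linear splitting. Series with constant term 1 form an
    abelian group, so [lambda_t] is an instance of [K0_lift]; its additivity, with that of
    composition with [u] and of the rank, gives [chernD]. In [gamma_red_class] the factor 1 - t
    coming from each trivial summand clears the denominators of the powers of u, and [chern_gt_rank]
    spreads the resulting bound over sums. For [chern_res], [K0_ext] reduces each compatibility with
    restriction to classes of connections. *)

Section Truncation.
Variable R : comNzRingType.
Implicit Types (f h : nat -> R) (P Q : {poly R}).

(** Series are compared with polynomials modulo t^(N+1), so that identities between series are
    inherited from the ring [{poly R}] through [eq_upto_eq]. *)
Definition eq_upto N f P := forall n, (n <= N)%N -> f n = P`_n.

Definition fps_trunc N f : {poly R} := \poly_(i < N.+1) f i.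

Lemma eq_upto_trunc N f : eq_upto N f (fps_trunc N f).
Proof. by move=> n nN; rewrite coef_poly ltnS nN. Qed.

Lemma eq_upto_mul N f h P Q :
  eq_upto N f P -> eq_upto N h Q -> eq_upto N (fps_mul f h) (P * Q).
Proof.
move=> fP hQ n nN; rewrite coefM; apply: eq_bigr => i _.
by rewrite fP ?hQ // (leq_trans _ nN) // ?leq_subr // -ltnS.
Qed.

Lemma eq_upto_coef_mul N P P' Q Q' :
  eq_upto N (fun n => P`_n) P' -> eq_upto N (fun n => Q`_n) Q' ->
  eq_upto N (fun n => (P * Q)`_n) (P' * Q').
Proof. by move=> PP QQ n nN; rewrite coefM; exact: eq_upto_mul PP QQ n nN. Qed.

Lemma eq_upto_one N : eq_upto N (@fps_one R) 1.
Proof. by move=> n _; rewrite coef1. Qed.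

Lemma eq_upto_sub N f h P Q :
  eq_upto N f P -> eq_upto N h Q -> eq_upto N (fps_sub f h) (P - Q).
Proof. by move=> fP hQ n nN; rewrite coefB /fps_sub fP ?hQ. Qed.

Lemma eq_upto_exp N f P m : eq_upto N f P -> eq_upto N (fps_exp f m) (P ^+ m).
Proof.
move=> fP; elim: m => [|m IH]; first exact: eq_upto_one.
by rewrite exprS; apply: eq_upto_mul.
Qed.

Lemma eq_upto_eq f h :
  (forall N, exists P, eq_upto N f P /\ eq_upto N h P) -> f = h.
Proof.
by move=> E; apply/funext => n; have [P [-> // ->]] := E n.
Qed.

(** [P] is divisible by ['X], hence [P ^+ m] by ['X^m]. *)
Lemma coef_exp_eq0 P m n : P`_0 = 0 -> (n < m)%N -> (P ^+ m)`_n = 0.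
Proof.
move=> P0; elim: m n => // m IH n; rewrite ltnS exprS coefM => nm.
apply: big1 => -[[|i] ilt] _ /=; first by rewrite P0 mul0r.
rewrite IH ?mulr0 //; case: n nm ilt => [|n] // nm ilt.
by rewrite subSS (leq_ltn_trans (leq_subr _ _)).
Qed.

Lemma eq_upto_comp N f h P Q : h 0 = 0 ->
  eq_upto N f P -> eq_upto N h Q -> eq_upto N (fps_comp f h) (P \Po Q).
Proof.
move=> h0 fP hQ n nN.
have Q0 : Q`_0 = 0 by rewrite -hQ.
(* The series sums over m <= n, the polynomial composite over m < [size P]. The excess terms vanish:
   Q^m starts in degree m, and [P] has no coefficients beyond its size. *)
have vanish (M M' : nat) (e : nat -> R) : (n < M)%N -> (M <= M')%N ->
    \sum_(m < M') e m * (Q ^+ m)`_n = \sum_(m < M) e m * (Q ^+ m)`_n.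
  move=> nM MM'; rewrite -!(big_mkord xpredT (fun m => e m * (Q ^+ m)`_n)).
  rewrite (big_cat_nat _ MM') //= [X in _ + X]big_nat.
  rewrite [X in _ + X]big1 ?addr0 // => i /andP[Mi _].
  by rewrite coef_exp_eq0 ?mulr0 ?(leq_trans nM).
rewrite /fps_comp coef_comp_poly.
transitivity (\sum_(m < n.+1) P`_m * (Q ^+ m)`_n).
  apply: eq_bigr => m _; have mn : (m <= n)%N by rewrite -ltnS.
  by rewrite fP ?(leq_trans mn) // (eq_upto_exp m hQ).
have [sn|ns] := leqP n.+1 (size P).
  by rewrite (vanish n.+1 (size P)).
rewrite -!(big_mkord xpredT (fun m => P`_m * (Q ^+ m)`_n)).
rewrite (big_cat_nat (leq0n (size P)) (ltnW ns)) //= [X in _ + X]big_nat.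
by rewrite [X in _ + X]big1 ?addr0 // => i /andP[Mi _]; rewrite nth_default ?mul0r.
Qed.

Lemma fps_mulA : associative (@fps_mul R).
Proof.
move=> f h e; apply: eq_upto_eq => N.
exists (fps_trunc N f * fps_trunc N h * fps_trunc N e); split.
  by rewrite -mulrA; do !apply: eq_upto_mul; apply: eq_upto_trunc.
by do !apply: eq_upto_mul; apply: eq_upto_trunc.
Qed.

Lemma fps_mulC : commutative (@fps_mul R).
Proof.
move=> f h; apply: eq_upto_eq => N.
exists (fps_trunc N f * fps_trunc N h); split; [|rewrite mulrC].
  by apply: eq_upto_mul; apply: eq_upto_trunc.
by apply: eq_upto_mul; apply: eq_upto_trunc.
Qed.

Lemma fps_mul1 : left_id (@fps_one R) (@fps_mul R).
Proof.
move=> f; apply: eq_upto_eq => N; exists (fps_trunc N f); split.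
  by rewrite -[fps_trunc N f]mul1r; apply: eq_upto_mul;
    [apply: eq_upto_one|apply: eq_upto_trunc].
exact: eq_upto_trunc.
Qed.

Lemma fps_mul_coef0 f h : fps_mul f h 0 = f 0 * h 0.
Proof. by rewrite /fps_mul big_ord1. Qed.

Lemma fps_comp_coef0 f h : fps_comp f h 0 = f 0.
Proof. by rewrite /fps_comp big_ord1 /= mulr1. Qed.

(** The truncated geometric sum in 1 - P, multiplied by P, is 1 - (1 - P)^(N+1); the last power
    starts in degree N + 1 because 1 - P has no constant term. *)
Lemma fps_invK f : f 0 = 1 -> fps_mul (fps_inv f) f = @fps_one R.
Proof.
move=> f0; apply: eq_upto_eq => N; exists 1; split; last exact: eq_upto_one.
pose P := fps_trunc N f; pose S := \poly_(i < N.+1) (1 : R).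
have d0 : fps_sub (@fps_one R) f 0 = 0 by rewrite /fps_sub f0 subrr.
have fP : eq_upto N f P by exact: eq_upto_trunc.
have dP : eq_upto N (fps_sub (@fps_one R) f) (1 - P).
  by apply: eq_upto_sub => //; apply: eq_upto_one.
have S1 : eq_upto N (fun=> 1) S by exact: eq_upto_trunc.
have iP : eq_upto N (fps_inv f) (S \Po (1 - P)) := eq_upto_comp d0 S1 dP.
move=> n nN; rewrite (eq_upto_mul iP fP nN).
have -> : S \Po (1 - P) = \sum_(i < N.+1) (1 - P) ^+ i.
  rewrite /S poly_def linear_sum; apply: eq_bigr => i _ /=.
  by rewrite linearZ /= comp_Xn_poly scale1r.
have -> : (\sum_(i < N.+1) (1 - P) ^+ i) * P = 1 - (1 - P) ^+ N.+1.
  rewrite mulrC -[X in X * _](_ : 1 - (1 - P) = _); last by rewrite opprB addrC subrK.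
  rewrite -[X in _ = X - _](expr1n _ N.+1) subrXX; congr (_ * _).
  by apply: eq_bigr => i _; rewrite expr1n mul1r.
by rewrite coefB coef_exp_eq0 ?subr0 // coefB coef1 -fP // f0 subrr.
Qed.

Lemma fps_comp_mul f e h : h 0 = 0 ->
  fps_comp (fps_mul f e) h = fps_mul (fps_comp f h) (fps_comp e h).
Proof.
move=> h0; apply: eq_upto_eq => N.
pose P := fps_trunc N f; pose Q := fps_trunc N e; pose H := fps_trunc N h.
exists ((P * Q) \Po H); split.
  by apply: eq_upto_comp => //; [apply: eq_upto_mul|]; apply: eq_upto_trunc.
rewrite comp_polyM; apply: eq_upto_mul; apply: eq_upto_comp => //; exact: eq_upto_trunc.
Qed.

Lemma fps_geometric :
  fps_mul (fun=> 1) (fps_sub (@fps_one R) (@fps_X R)) = @fps_one R.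
Proof.
apply/funext => -[|n]; first by rewrite fps_mul_coef0 mul1r /fps_sub subr0.
rewrite /fps_mul !big_ord_recr /= big1 ?add0r => [|j _].
  by rewrite subnn subSn // subnn /fps_sub /fps_one /fps_X /=; ring.
have jn := ltn_ord j; have -> : (n.+1 - j = (n - j.+1).+2)%N by lia.
by rewrite mul1r /fps_sub /fps_one /fps_X subrr.
Qed.

(** The closed form t + t^2 + ... shows that u has no constant term, so that composition with it is
    multiplicative, and that its coefficients are 0 or 1, hence preserved by ring morphisms. *)
Lemma fps_uE : @fps_u R = fun n => (0 < n)%:R.
Proof.
have E : fps_inv (fps_sub (@fps_one R) (@fps_X R)) = fun=> 1.
  set i := fps_inv _; rewrite -[LHS]fps_mul1 -fps_geometric -fps_mulA.
  rewrite [fps_mul _ i]fps_mulC fps_invK; last by rewrite /fps_sub subr0.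
  by rewrite fps_mulC fps_mul1.
apply/funext => n; rewrite /fps_u E /fps_mul.
under eq_bigr do rewrite mulr1.
case: n => [|n]; first by rewrite big_ord1.
by rewrite !big_ord_recl /= big1 ?addr0 ?add0r // /fps_X.
Qed.

Lemma fps_u_mul : fps_mul (@fps_u R) (fps_sub (@fps_one R) (@fps_X R)) = @fps_X R.
Proof.
rewrite /fps_u -fps_mulA fps_invK; last by rewrite /fps_sub subr0.
by rewrite fps_mulC fps_mul1.
Qed.

End Truncation.

(** * Filtrations by coordinate subspaces *)

Lemma nablaP (K : fieldType) (p : nat) (k : divringClosed K) (g : pLieAlg p k)
    (V : vectType K) (N : connection g V) (D : pLie_elt g) (c : K) (u v : V) :
  N D (c *: u + v) = c *: N D u + (D c *: u + N D v).
Proof. by rewrite nablaD nabla_Leibniz addrA. Qed.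

Section CoordinateFiltration.
Variables (K : fieldType) (p : nat) (k : divringClosed K) (g : pLieAlg p k).
Variables (T : finType) (N : connection g {ffun T -> K^o}).
Implicit Types (P Q : pred T) (y : {ffun T -> K^o}) (D : pLie_elt g).

Definition fext P (x : {ffun {t | P t} -> K^o}) : {ffun T -> K^o} :=
  [ffun t => if insub t is Some u then x u else 0].

Definition fres P y : {ffun {t | P t} -> K^o} := [ffun u => y (val u)].

Lemma fext_out P x t : ~~ P t -> @fext P x t = 0.
Proof. by move=> Pt; rewrite ffunE insubF //; apply/negbTE. Qed.

Lemma fext_res P y t : fext (fres P y) t = if P t then y t else 0.
Proof.
rewrite ffunE; case: insubP => [u Pu tu|/negPf->//].
by rewrite Pu ffunE tu.
Qed.

Lemma fextK P : cancel (@fext P) (fres P).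
Proof. by move=> x; apply/ffunP => u; rewrite !ffunE valK. Qed.

Lemma fext_linear P : linear (@fext P).
Proof.
move=> a x y; apply/ffunP => t; rewrite !ffunE; case: insubP => [u _ _|_].
  by rewrite !ffunE.
by rewrite scaler0 addr0.
Qed.

Lemma fres_linear P : linear (fres P).
Proof. by move=> a x y; apply/ffunP => u; rewrite !ffunE. Qed.

HB.instance Definition _ P :=
  GRing.isLinear.Build K _ _ _ (@fext P) (@fext_linear P).
HB.instance Definition _ P :=
  GRing.isLinear.Build K _ _ _ (fres P) (@fres_linear P).

(** The compression of [N] to the coordinates in [P] is a connection for every [P], stable or not,
    so subobjects, quotients and graded pieces of a coordinate filtration all have this one form. *)
Definition sub_nabla P D (x : {ffun {t | P t} -> K^o}) := fres P (N D (fext x)).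

Lemma sub_nablaD P D u v :
  @sub_nabla P D (u + v) = sub_nabla D u + sub_nabla D v.
Proof. by rewrite /sub_nabla linearD nablaD linearD. Qed.

Lemma sub_nabla_comb P a D1 D2 v :
  @sub_nabla P (elt_comb a D1 D2) v = a *: sub_nabla D1 v + sub_nabla D2 v.
Proof. by rewrite /sub_nabla nabla_comb linearP. Qed.

Lemma sub_nabla_Leibniz P D a v :
  @sub_nabla P D (a *: v) = a *: sub_nabla D v + D a *: v.
Proof. by rewrite /sub_nabla linearZ nabla_Leibniz linearP linearZ /= fextK. Qed.

Definition sub_conn P : conn g :=
  Conn (mk_connection (@sub_nablaD P) (@sub_nabla_comb P) (@sub_nabla_Leibniz P)).

Definition supported_on P y := forall t, ~~ P t -> y t = 0.

Definition supp_stable P :=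
  forall D y, supported_on P y -> supported_on P (N D y).

(** Depending on which of [P] and [Q] contains the other, this is a coordinate inclusion or a
    coordinate projection. *)
Definition transfer P Q : 'Hom(sub_conn P, sub_conn Q) :=
  linfun (fres Q \o @fext P).

Lemma fext_transfer P Q (x : sub_conn P) t :
  fext (transfer P Q x) t = if Q t then fext x t else 0.
Proof. by rewrite lfunE /= fext_res. Qed.

Lemma sub_conn_split P Q : {subset Q <= P} -> supp_stable Q ->
  K0_class (sub_conn P) =
  K0_class (sub_conn Q) + K0_class (sub_conn [pred t | P t && ~~ Q t]).
Proof.
set E := [pred t | _]; move=> QP stQ; have {}QP t : Q t -> P t by apply: QP.
apply: (@K0_class_ses _ _ _ _ (sub_conn Q) (sub_conn P) (sub_conn E)
  (transfer Q P) (transfer P E)).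
have xE P' (x x' : sub_conn P') : fext x =1 fext x' -> x = x'.
  by move=> xx'; rewrite -[x]fextK -[x']fextK; congr fres; apply/ffunP.
have nE P' D (x : sub_conn P') t : fext (conn_nabla (sub_conn P') D x) t =
    if P' t then N D (fext x) t else 0 by rewrite /= fext_res.
apply/short_exact_split; split=> [D x|D x|].
- apply: xE => t; rewrite !(fext_transfer, nE).
  have -> : fext (transfer Q P x) = fext x.
    apply/ffunP => {}t; rewrite fext_transfer; case: ifP => // /negbT Pt.
    by rewrite fext_out // (contra (QP t)).
  case: ifP => // _; case: ifP => // /negbT Qt.
  by rewrite stQ // => t' Qt'; rewrite fext_out.
- apply: xE => t; rewrite !(fext_transfer, nE).
  case: ifP => // /andP[Pt Qt]; rewrite Pt; apply/eqP; rewrite -subr_eq0.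
  set y := fext (transfer P E x).
  (* The difference [fext x - y] is supported on [Q], which [N D] preserves, so it contributes
     nothing at [t], a point outside [Q]. *)
  have -> : fext x = (fext x - y) + y by rewrite subrK.
  have subE (a b : {ffun T -> K^o}) s : (a - b) s = a s - b s by rewrite !ffunE.
  rewrite nablaD ffunE addrK stQ // => t' Qt'; rewrite subE.
  rewrite /y fext_transfer /= Qt' andbT; case: ifP => [_|/negbT Pt'].
    by rewrite subrr.
  by rewrite fext_out // subrr.
exists (transfer P Q), (transfer E P); split=> x; apply: xE => t.
- rewrite !fext_transfer; case: (boolP (Q t)) => [/QP->//|Qt].
  by rewrite fext_out.
- rewrite !fext_transfer; case: (boolP (E t)) => [/andP[->//]|Et].
  by rewrite fext_out.
- have -> : fext (0 : sub_conn E) t = 0 by rewrite linear0 ffunE.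
  rewrite !fext_transfer; case: ifP => // /andP[-> Qt].
  by rewrite fext_out.
- have -> (a b : sub_conn P) : fext (a + b) t = fext a t + fext b t.
    by rewrite linearD [LHS]ffunE.
  rewrite !fext_transfer /=; case: (boolP (P t)) => [_|Pt] /=.
    by case: (Q t); rewrite ?addr0 ?add0r.
  by rewrite addr0 fext_out.
Qed.

Lemma iso_sub_conn_predT P : P =1 predT -> iso (Conn N) (sub_conn P).
Proof.
move=> PT; apply: (@mk_iso _ _ _ _ (Conn N) (sub_conn P) (fres P) (@fext P)).
- exact: fres_linear.
- exact: fext_linear.
- move=> D v /=; rewrite /sub_nabla; congr (fres P (N D _)).
  by apply/ffunP => t; rewrite fext_res PT.
- by move=> y; apply/ffunP => t; rewrite fext_res PT.
- exact: fextK.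
Qed.

Lemma K0_class_dim0 (V : conn g) : (forall v : V, v = 0) -> K0_class V = 0.
Proof.
move=> V0; rewrite -(@K0_class0 _ _ _ g); apply: K0_class_iso.
apply: (@mk_iso _ _ _ _ V (zero_conn g) (fun=> 0) (fun=> 0)) => //.
- by move=> a u v; rewrite scaler0 addr0.
- by move=> a u v; rewrite scaler0 addr0.
- by move=> v; apply/esym/thinmx0.
Qed.

Lemma K0_class_filtration (P : nat -> pred T) n :
  P 0 =1 predT -> P n =1 pred0 ->
  (forall m, {subset P m.+1 <= P m}) -> (forall m, supp_stable (P m)) ->
  K0_class (Conn N) =
  \sum_(m < n) K0_class (sub_conn [pred t | P m t && ~~ P m.+1 t]).
Proof.
move=> P0 Pn Pdec Pst; rewrite (K0_class_iso (iso_sub_conn_predT P0)).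
have z : K0_class (sub_conn (P n)) = 0.
  apply: K0_class_dim0 => v; apply/ffunP => -[t Pt].
  by have := Pt; rewrite Pn.
suff -> : K0_class (sub_conn (P 0)) =
    \sum_(m < n) K0_class (sub_conn [pred t | P m t && ~~ P m.+1 t]) +
    K0_class (sub_conn (P n)) by rewrite z addr0.
elim: n {Pn z} => [|n IH]; first by rewrite big_ord0 add0r.
rewrite big_ord_recr /= -addrA IH; congr (_ + _).
by rewrite (sub_conn_split (Pdec n) (Pst n.+1)) addrC.
Qed.

End CoordinateFiltration.

(** * Exterior powers of block triangular connections *)

(** By the pigeonhole principle no permutation maps [A] into [B], so each term of the expansion
    contains a vanishing entry. *)
Lemma det_zero_block (R : comNzRingType) n (M : 'M[R]_n) (A B : {set 'I_n}) :
  (#|B| < #|A|)%N -> (forall i j, i \in A -> j \notin B -> M i j = 0) ->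
  \det M = 0.
Proof.
move=> BA M0; apply: big1 => s _.
have [i iA siB] : exists2 i, i \in A & s i \notin B.
  apply/exists_inP; rewrite -negb_forall_in; apply: contraL BA => /forall_inP sAB.
  rewrite -leqNgt -(card_imset _ (@perm_inj _ s)); apply: subset_leq_card.
  by apply/subsetP => _ /imsetP[i iA ->]; apply: sAB.
by rewrite (bigD1 i) //= M0 // mul0r mulr0.
Qed.

Lemma card_ord_lt n m : (m <= n)%N -> #|[set i : 'I_n | (i < m)%N]| = m.
Proof.
move=> mn; rewrite -[RHS]card_ord -[RHS]cardsT.
have inj : injective (widen_ord mn) by move=> i j [/val_inj].
rewrite -(card_imset _ inj); apply: eq_card => i; rewrite inE.
apply/idP/imsetP => [im|[j _ ->]]; last exact: (ltn_ord j).
by exists (Ordinal im); [rewrite inE | apply: val_inj].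
Qed.

Lemma split_lshiftE (n1 n2 : nat) (i : 'I_n1) : split (lshift n2 i) = inl i.
Proof. exact: (unsplitK (inl _ i)). Qed.

Lemma split_rshiftE (n1 n2 : nat) (i : 'I_n2) : split (rshift n1 i) = inr i.
Proof. exact: (unsplitK (inr _ i)). Qed.

Lemma linear_sumZ (K : fieldType) (U1 U2 : lmodType K) (f : U1 -> U2) (I : finType)
    (c : I -> K) (e : I -> U1) : linear f ->
  f (\sum_i c i *: e i) = \sum_i c i *: f (e i).
Proof.
move=> fl; pose fL := GRing.isLinear.Build K _ _ _ f fl.
pose f' : {linear U1 -> U2} := HB.pack f fL.
by rewrite -[f]/(f' : _ -> _) linear_sum; apply: eq_bigr => i _; rewrite linearZ.
Qed.

Lemma wedge_updD (K : fieldType) (p : nat) (k : divringClosed K) (g : pLieAlg p k)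
    (l : nat) (U : conn g) (v : 'I_l -> U) i x y :
  wedge (upd v i (x + y)) = wedge (upd v i x) + wedge (upd v i y).
Proof. by rewrite -[x]scale1r wedge_lin !scale1r. Qed.

Section BlockConnection.
Variables (K : fieldType) (p : nat) (k : divringClosed K) (g : pLieAlg p k).
Variables (V1 V2 : conn g) (N : connection g (V1 * V2)%type).
Let W : conn g := Conn N.
Notation a := (dim V1).
Notation b := (dim V2).

(* [v2r] is opaque on a product, so [(v1, v2)] is represented by the element    *)
(* with coordinates [row_mx (v2r v1) (v2r v2)] instead of by the pair.          *)
Definition block_inl (v : V1) : W := r2v (row_mx (v2r v) 0 : 'rV_(a + b)).
Definition block_inr (v : V2) : W := r2v (row_mx 0 (v2r v) : 'rV_(a + b)).
Definition block_prr (x : W) : V2 := r2v (rsubmx (v2r x : 'rV_(a + b))).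

(** Block triangularity: [V1] is a subconnection and [V2] the quotient. Nothing is assumed on the
    component from [V2] to [V1], so [block_inr] need not respect the connections. *)
Hypothesis nabla_inl : forall D v, N D (block_inl v) = block_inl (conn_nabla V1 D v).
Hypothesis prr_nabla : forall D x, block_prr (N D x) = conn_nabla V2 D (block_prr x).

Lemma block_inl_coord v (i : 'I_(a + b)) :
  v2r (block_inl v) 0 i = if split i is inl i' then v2r v 0 i' else 0.
Proof. by rewrite /block_inl r2vK mxE; case: split => // j; rewrite mxE. Qed.

Lemma block_inr_coord v (i : 'I_(a + b)) :
  v2r (block_inr v) 0 i = if split i is inr i' then v2r v 0 i' else 0.
Proof. by rewrite /block_inr r2vK mxE; case: split => // j; rewrite mxE. Qed.

Lemma block_prr0P x :
  block_prr x = 0 <-> forall i : 'I_(a + b), (a <= i)%N -> v2r x 0 i = 0.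
Proof.
split=> [x0 i ai|x0]; last first.
  apply: v2r_inj; rewrite r2vK linear0; apply/rowP => j; rewrite !mxE.
  by rewrite x0 //= leq_addr.
have := congr1 v2r x0; rewrite r2vK linear0 => /rowP e.
case: (splitP i) => j ij; first by move: ai; rewrite ij leqNgt ltn_ord.
have -> : i = rshift a j by apply/val_inj.
by have := e j; rewrite !mxE.
Qed.

Lemma block_prrK v : block_prr (block_inr v) = v.
Proof. by rewrite /block_prr /block_inr r2vK row_mxKr v2rK. Qed.

Lemma block_decomp x :
  x = block_inl (r2v (lsubmx (v2r x : 'rV_(a + b)))) + block_inr (block_prr x).
Proof.
apply: v2r_inj; apply/rowP => i; rewrite linearD [RHS]mxE.
rewrite block_inl_coord block_inr_coord; case: splitP => j ij.
  by rewrite r2vK mxE addr0; congr (v2r x 0 _); apply: val_inj.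
by rewrite r2vK mxE add0r; congr (v2r x 0 _); apply: val_inj.
Qed.

Section Weight.
Variable l : nat.

(** As [t] increases, at least [m] of its indices lie below [a] exactly when the first [m] do. The
    quantifier over ['I_l] saturates at m = l; the conjunct [m <= l] makes the filtration end at
    zero. *)
Definition block_ge m (t : incr l (a + b)) : bool :=
  (m <= l)%N && [forall c : 'I_l, (c < m)%N ==> (val t c < a)%N].

(** Some column c < m has an index at least [a], and so do all later columns: the first [m] rows,
    which come from [V1], vanish outside the first [c] columns. *)
Lemma wedge_block_ge0 m (v : 'I_l -> W) (t : incr l (a + b)) : (m <= l)%N ->
  (forall c : 'I_l, (c < m)%N -> block_prr (v c) = 0) -> ~~ block_ge m t ->
  wedge v t = 0.
Proof.
move=> ml v0; rewrite /block_ge ml negb_forall => /existsP[c].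
rewrite negb_imply -leqNgt => /andP[cm tc]; rewrite ffunE.
apply: (@det_zero_block _ _ _ [set i : 'I_l | (i < m)%N] [set i : 'I_l | (i < c)%N]).
  by rewrite !card_ord_lt // ltnW.
move=> i j; rewrite !inE -leqNgt => im cj; rewrite mxE.
apply: (block_prr0P (v i)).1; first exact: v0.
move: cj; rewrite leq_eqVlt => /orP[/eqP/val_inj<-//|/(incr_lt t)/ltnW].
exact: leq_trans.
Qed.

(** The Leibniz rule changes one factor at a time, and by [prr_nabla] a factor in the kernel of
    [block_prr] stays there. *)
Lemma block_ge_stable m : supp_stable (conn_nabla (ext_conn l W)) (block_ge m).
Proof.
have [ml|lm] := leqP m l; last first.
  move=> D y y0 t _; have -> : y = 0.
    by apply/ffunP => s; rewrite y0 ?ffunE // /block_ge leqNgt lm.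
  by rewrite nabla0 ffunE.
move=> D y y0 t tm; rewrite /= sum_ffunE; apply: big1 => s _.
have [sm|sm] := boolP (block_ge m s); last first.
  by rewrite y0 // elt0 !scale0r addr0 ffunE.
have sprr (c : 'I_l) : (c < m)%N -> block_prr (basis (val s c) : W) = 0.
  move=> cm; apply/block_prr0P => i ai; rewrite /basis r2vK mxE eqxx /=.
  have := sm; rewrite /block_ge ml => /forallP/(_ c); rewrite cm /= => sc.
  by case: eqP => // ie; move: ai; rewrite ie leqNgt sc.
rewrite ffunE ffunE (wedge_block_ge0 ml sprr tm) scaler0 add0r ffunE sum_ffunE.
rewrite big1 ?scaler0 // => i _; apply: (wedge_block_ge0 ml) => // c cm.
rewrite /upd; case: eqP => [ci|_]; last exact: sprr.
by rewrite prr_nabla -ci sprr // nabla0.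
Qed.

End Weight.


Section Piece.
Variables m q : nat.
Implicit Types (t : incr (m + q) (a + b)) (s : incr m a) (r : incr q b).

Definition block_piece := [pred t : incr (m + q) (a + b) | block_ge m t && ~~ block_ge m.+1 t].

Lemma block_pieceP t :
  reflect (forall c : 'I_(m + q), (val t c < a)%N = (c < m)%N) (block_piece t).
Proof.
apply: (iffP andP) => [[/andP[_ /forallP tm]]|tE].
  rewrite negb_and => tm1 c; apply/idP/idP => [tc|cm]; last exact: (implyP (tm c)).
  rewrite ltnNge; apply/negP => mc; case/orP: tm1 => [|/forallPn[d]].
    by rewrite -ltnNge ltnS => lm; have := ltn_ord c; rewrite ltnNge (leq_trans lm).
  rewrite negb_imply ltnS -leqNgt => /andP[dm ad].
  have: (val t d <= val t c)%N.
    have := leq_trans dm mc; rewrite leq_eqVlt => /orP[/eqP/val_inj->//|].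
    by move=> /(incr_lt t)/ltnW.
  by move=> /(leq_trans ad); rewrite leqNgt tc.
split; rewrite /block_ge.
  by rewrite leq_addr; apply/forallP => c; rewrite tE implybb.
apply/nandP; have [mq|_] := ltnP m (m + q); last by left.
by right; apply/forallPn; exists (Ordinal mq); rewrite tE /= ltnS leqnn ltnn.
Qed.

Definition block_index s r (c : 'I_(m + q)) : 'I_(a + b) :=
  match split c with inl i => lshift b (val s i) | inr j => rshift a (val r j) end.

Lemma block_index_incr s r :
  [forall i : 'I_(m + q), forall j : 'I_(m + q), (i < j)%N ==>
     ([ffun c => block_index s r c] i < [ffun c => block_index s r c] j)%N].
Proof.
apply/'forall_forallP => i j; apply/implyP; rewrite !ffunE /block_index.
case: (splitP i) => i' ->; case: (splitP j) => j' -> /=.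
- exact: incr_lt.
- by move=> _; rewrite ltn_addr.
- by have := ltn_ord j'; lia.
- by rewrite !ltn_add2l; apply: incr_lt.
Qed.

Definition block_incr s r : incr (m + q) (a + b) :=
  exist _ [ffun c => block_index s r c] (block_index_incr s r).

Lemma block_incr_surj t : block_piece t -> exists s r, t = block_incr s r.
Proof.
move=> /block_pieceP tE.
have /fin_all_exists[f1 f1E] (i : 'I_m) : exists j : 'I_a, val t (lshift q i) = lshift b j.
  have ti : (val t (lshift q i) < a)%N by rewrite tE /=.
  by exists (Ordinal ti); apply: val_inj.
have /fin_all_exists[f2 f2E] (i : 'I_q) : exists j : 'I_b, val t (rshift m i) = rshift a j.
  case: (splitP (val t (rshift m i))) => j tj; last by exists j; apply: val_inj.
  have := tE (rshift m i); rewrite tj ltn_ord /= => /esym.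
  by rewrite ltnNge leq_addr.
have f1i : [forall i : 'I_m, forall j : 'I_m, (i < j)%N ==>
    ([ffun i => f1 i] i < [ffun i => f1 i] j)%N].
  apply/'forall_forallP => i j; apply/implyP => ij; rewrite !ffunE.
  have := @incr_lt _ _ t (lshift q i) (lshift q j) ij.
  by rewrite !f1E.
have f2i : [forall i : 'I_q, forall j : 'I_q, (i < j)%N ==>
    ([ffun i => f2 i] i < [ffun i => f2 i] j)%N].
  apply/'forall_forallP => i j; apply/implyP => ij; rewrite !ffunE.
  have := @incr_lt _ _ t (rshift m i) (rshift m j).
  by rewrite !f2E /= !ltn_add2l; apply.
pose s : incr m a := exist _ [ffun i => f1 i] f1i.
pose r : incr q b := exist _ [ffun i => f2 i] f2i.
exists s, r; apply/val_inj/ffunP => c /=.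
rewrite ffunE /block_index; case: (splitP c) => j cj /=; rewrite ffunE.
  by rewrite -f1E; congr (val t _); apply: val_inj.
by rewrite -f2E; congr (val t _); apply: val_inj.
Qed.

Definition block_cat (u : 'I_m -> V1) (v : 'I_q -> V2) (c : 'I_(m + q)) : W :=
  match split c with inl i => block_inl (u i) | inr j => block_inr (v j) end.

Lemma block_catl u v i : block_cat u v (lshift q i) = block_inl (u i).
Proof. by rewrite /block_cat split_lshiftE. Qed.

Lemma block_catr u v j : block_cat u v (rshift m j) = block_inr (v j).
Proof. by rewrite /block_cat split_rshiftE. Qed.

Lemma block_cat_updl u v i z :
  upd (block_cat u v) (lshift q i) (block_inl z) = block_cat (upd u i z) v.
Proof.
apply/funext => c; rewrite /upd /block_cat.
case: splitP => j cj.
  by rewrite -val_eqE /= cj (val_eqE j i); case: eqP.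
by rewrite -val_eqE /= cj gtn_eqF // ltn_addr.
Qed.

Lemma block_cat_updr u v i z :
  upd (block_cat u v) (rshift m i) (block_inr z) = block_cat u (upd v i z).
Proof.
apply/funext => c; rewrite /upd /block_cat.
case: splitP => j cj.
  by rewrite -val_eqE /= cj ltn_eqF // ltn_addr.
by rewrite -val_eqE /= cj eqn_add2l (val_eqE j i); case: eqP.
Qed.

(** The minor is block diagonal. *)
Lemma wedge_block_cat u v s r :
  wedge (block_cat u v) (block_incr s r) = wedge u s * wedge v r.
Proof.
rewrite !ffunE -(det_lblock _ 0); congr (\det _); apply/matrixP => i j.
rewrite [LHS]mxE ffunE /block_cat /block_index /block_mx.
rewrite mxE; case: splitP => i' _; rewrite mxE; case: splitP => j' _;
  by rewrite ?block_inl_coord ?block_inr_coord ?split_lshiftE ?split_rshiftE !mxE.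
Qed.

(* The off-diagonal part of the connection inserts a factor from [V1]: it leaves *)
(* the graded piece.                                                           *)
Lemma wedge_block_cat_updr_inl u v j z t : block_piece t ->
  wedge (upd (block_cat u v) (rshift m j) (block_inl z)) t = 0.
Proof.
move=> /block_pieceP tE; rewrite ffunE.
apply: (@det_zero_block _ _ _ (rshift m j |: [set i : 'I_(m + q) | (i < m)%N])
  [set i : 'I_(m + q) | (i < m)%N]).
  by rewrite cardsU1 inE /= -leqNgt leq_addr.
move=> i c; rewrite !inE mxE => iA; rewrite -tE => tc.
have -> : upd (block_cat u v) (rshift m j) (block_inl z) i =
    block_inl (if split i is inl i' then u i' else z).
  rewrite /upd /block_cat; case: eqP => [->|/eqP ij].
    by rewrite split_rshiftE.
  by move: iA; rewrite (negPf ij) /=; case: splitP.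
by rewrite block_inl_coord; case: splitP tc.
Qed.

Lemma wedge_block_cat_supp u v t : ~~ block_piece t ->
  wedge (block_cat u v) t = 0.
Proof.
have inl0 i : block_prr (block_inl i) = 0.
  by rewrite /block_prr /block_inl r2vK row_mxKr linear0.
rewrite negb_and negbK => /orP[tm|/andP[mq /forallP tm]].
  apply: (wedge_block_ge0 _ _ tm); first exact: leq_addr.
  by move=> c cm; rewrite /block_cat; case: splitP cm.
(* Here at least m + 1 indices of [t] lie below [a]. These columns vanish on all rows except the
   first [m], so the pigeonhole argument applies to the transpose. *)
rewrite ffunE -det_tr.
apply: (@det_zero_block _ _ _ [set i : 'I_(m + q) | (i < m.+1)%N]
  [set i : 'I_(m + q) | (i < m)%N]); first by rewrite !card_ord_lt // ltnW.
move=> i j; rewrite !inE !mxE => im mj.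
rewrite /block_cat; case: splitP mj => // j' _ _; rewrite block_inr_coord.
by have := implyP (tm i) im; case: splitP.
Qed.

(** The wedge product of ∧^m V1 and ∧^q V2 inside ∧^(m+q) W, given on bases; [block_mul_wedge]
    identifies it on all decomposable elements. *)
Definition block_mul (x : ext_space m V1) (y : ext_space q V2) : ext_space (m + q) W :=
  \sum_s \sum_r (x s * y r) *:
    wedge (block_cat (fun i => basis (val s i)) (fun i => basis (val r i))).

Lemma block_mul_linl c x x' y :
  block_mul (c *: x + x') y = c *: block_mul x y + block_mul x' y.
Proof.
rewrite scaler_sumr -big_split; apply: eq_bigr => s _.
rewrite scaler_sumr -big_split; apply: eq_bigr => r _ /=.
by rewrite scalerA -scalerDl !ffunE mulrDl mulrA.
Qed.

Lemma block_mul_linr c x y y' :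
  block_mul x (c *: y + y') = c *: block_mul x y + block_mul x y'.
Proof.
rewrite scaler_sumr -big_split; apply: eq_bigr => s _.
rewrite scaler_sumr -big_split; apply: eq_bigr => r _ /=.
by rewrite scalerA -scalerDl !ffunE mulrDr mulrCA.
Qed.

Lemma block_mul_basis s r :
  block_mul (wedge (fun i => basis (val s i))) (wedge (fun i => basis (val r i))) =
  wedge (block_cat (fun i => basis (val s i)) (fun i => basis (val r i))).
Proof.
rewrite /block_mul (bigD1 s) //= [X in _ + X]big1 ?addr0; last first.
  move=> s' /negPf ss'; apply: big1 => r' _.
  by rewrite wedge_basis eq_sym ss' mul0r scale0r.
rewrite (bigD1 r) //= [X in _ + X]big1 ?addr0; last first.
  by move=> r' /negPf rr'; rewrite !wedge_basis [r == r']eq_sym rr' mulr0 scale0r.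
by rewrite !wedge_basis !eqxx mulr1 scale1r.
Qed.

Lemma block_inl_linear : linear block_inl.
Proof.
move=> c x y; apply: v2r_inj; apply/rowP => i.
have P u v : v2r (c *: u + v : W) 0 i = c * v2r u 0 i + v2r v 0 i.
  by rewrite linearP !mxE.
rewrite P !block_inl_coord; case: split => j; last first.
  by rewrite mulr0 addr0.
by rewrite linearP !mxE.
Qed.

Lemma block_inr_linear : linear block_inr.
Proof.
move=> c x y; apply: v2r_inj; apply/rowP => i.
have P u v : v2r (c *: u + v : W) 0 i = c * v2r u 0 i + v2r v 0 i.
  by rewrite linearP !mxE.
rewrite P !block_inr_coord; case: split => j.
  by rewrite mulr0 addr0.
by rewrite linearP !mxE.
Qed.

Lemma wedge_block_cat_linl u v i c x y :
  wedge (block_cat (upd u i (c *: x + y)) v) =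
  c *: wedge (block_cat (upd u i x) v) + wedge (block_cat (upd u i y) v).
Proof. by rewrite -!block_cat_updl block_inl_linear wedge_lin. Qed.

Lemma wedge_block_cat_linr u v i c x y :
  wedge (block_cat u (upd v i (c *: x + y))) =
  c *: wedge (block_cat u (upd v i x)) + wedge (block_cat u (upd v i y)).
Proof. by rewrite -!block_cat_updr block_inr_linear wedge_lin. Qed.

Lemma wedge_block_cat_altl u v i j : i != j -> u i = u j ->
  wedge (block_cat u v) = 0.
Proof.
move=> ij uij; apply: (@wedge_alt _ _ _ _ _ _ _ (lshift q i) (lshift q j)) => //.
by rewrite /block_cat !split_lshiftE uij.
Qed.

Lemma wedge_block_cat_altr u v i j : i != j -> v i = v j ->
  wedge (block_cat u v) = 0.
Proof.
move=> ij vij; apply: (@wedge_alt _ _ _ _ _ _ _ (rshift m i) (rshift m j)).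
  by rewrite (inj_eq (@rshift_inj _ _)).
by rewrite /block_cat !split_rshiftE vij.
Qed.

Lemma block_mul0l y : block_mul 0 y = 0.
Proof. by have := block_mul_linl (-1) 0 0 y; rewrite scaler0 addr0 scaleN1r addNr. Qed.
Lemma block_mul0r x : block_mul x 0 = 0.
Proof. by have := block_mul_linr (-1) x 0 0; rewrite scaler0 addr0 scaleN1r addNr. Qed.

(** Both sides are alternating and multilinear in [u], then in [v], so two uses of [Phi_eq0] leave
    only basis vectors. *)
Lemma block_mul_wedge u v : block_mul (wedge u) (wedge v) = wedge (block_cat u v).
Proof.
apply/eqP; rewrite -subr_eq0; apply/eqP.
apply: (@Phi_eq0 _ _ _ _ m V1 _
  (fun u => block_mul (wedge u) (wedge v) - wedge (block_cat u v))) => {u}.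
- move=> u i c x y; rewrite wedge_lin wedge_block_cat_linl block_mul_linl.
  by rewrite scalerBr opprD addrACA.
- move=> u i j ij uij; rewrite (wedge_block_cat_altl v ij uij) (wedge_alt ij uij).
  by rewrite block_mul0l subrr.
move=> s; apply: (@Phi_eq0 _ _ _ _ q V2 _ (fun v => block_mul (wedge _) (wedge v) -
  wedge (block_cat (fun i => basis (val s i)) v))) => {v}.
- move=> v i c x y; rewrite wedge_lin wedge_block_cat_linr block_mul_linr.
  by rewrite scalerBr opprD addrACA.
- move=> v i j ij vij; rewrite (wedge_block_cat_altr _ ij vij) (wedge_alt ij vij).
  by rewrite block_mul0r subrr.
by move=> r; rewrite block_mul_basis subrr.
Qed.

(** The Leibniz rule for the wedge product holds only on the graded piece: elsewhere the
    off-diagonal part of [N] contributes. *)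
Lemma nabla_block_mul D x y t : block_piece t ->
  conn_nabla (ext_conn (m + q) W) D (block_mul x y) t =
  block_mul (conn_nabla (ext_conn m V1) D x) y t +
  block_mul x (conn_nabla (ext_conn q V2) D y) t.
Proof.
move=> tE; pose F x' y' : ext_space (m + q) W :=
  conn_nabla (ext_conn (m + q) W) D (block_mul x' y') -
  (block_mul (conn_nabla (ext_conn m V1) D x') y' +
   block_mul x' (conn_nabla (ext_conn q V2) D y')).
(* [r2] stands for the term in [D c]. It cancels, so the defect [F] is [K]-linear in each argument,
   which a connection is not, and it suffices to test [F] on wedges. *)
have AG (Z : zmodType) (r1 r2 r3 r4 r5 r6 r7 : Z) :
    (r1 + (r2 + r3)) - ((r4 + (r2 + r5)) + (r6 + r7)) =
    (r1 - (r4 + r6)) + (r3 - (r5 + r7)).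
  rewrite (addrCA r4) -[r2 + _ + _]addrA (addrACA r4) (addrCA r1).
  by rewrite opprD [LHS]addrACA subrr add0r opprD [LHS]addrACA.
have AG' (Z : zmodType) (r1 r2 r3 r4 r5 r6 r7 : Z) :
    (r1 + (r2 + r3)) - ((r6 + r7) + (r4 + (r2 + r5))) =
    (r1 - (r6 + r4)) + (r3 - (r7 + r5)).
  by rewrite [(r6 + r7) + _]addrC AG [r6 + r4]addrC [r7 + r5]addrC.
have Fl y' : linear (F^~ y').
  move=> c u v; rewrite /F block_mul_linl !nablaP !block_mul_linl.
  by apply: etrans (AG _ _ _ _ _ _ _ _) _; rewrite -!scalerDr -scalerBr.
have Fr x' : linear (F x').
  move=> c u v; rewrite /F block_mul_linr !nablaP !block_mul_linr.
  by apply: etrans (AG' _ _ _ _ _ _ _ _) _; rewrite -!scalerDr -scalerBr.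
suff: F x y t = 0 by rewrite /F !ffunE => /eqP; rewrite subr_eq0 => /eqP.
rewrite [x]ext_sumE (linear_sumZ _ _ (Fl y)) sum_ffunE big1 // => s _.
rewrite ffunE [y]ext_sumE (linear_sumZ _ _ (Fr _)) sum_ffunE big1 ?scaler0 // => r _.
rewrite ffunE; suff F0 u v : (F (wedge u) (wedge v) : {ffun _ -> K^o}) t = 0 by rewrite F0 scaler0.
have mul_suml (I : finType) (z : I -> ext_space m V1) z' :
    block_mul (\sum_i z i) z' = \sum_i block_mul (z i) z'.
  apply: (big_morph (block_mul^~ z')) => [z1 z2|]; last exact: block_mul0l.
  by have := block_mul_linl 1 z1 z2 z'; rewrite !scale1r.
have mul_sumr (I : finType) z (z' : I -> ext_space q V2) :
    block_mul z (\sum_i z' i) = \sum_i block_mul z (z' i).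
  apply: (big_morph (block_mul z)) => [z1 z2|]; last exact: block_mul0r.
  by have := block_mul_linr 1 z z1 z2; rewrite !scale1r.
rewrite /F block_mul_wedge /= !ext_nabla_wedge mul_suml mul_sumr big_split_ord /=.
have -> : \sum_i block_mul (wedge (upd u i (conn_nabla V1 D (u i)))) (wedge v) =
    \sum_(i < m) wedge (upd (block_cat u v) (lshift q i) (N D (block_cat u v (lshift q i)))).
  apply: eq_bigr => i _; rewrite block_mul_wedge.
  by rewrite block_catl nabla_inl block_cat_updl.
rewrite opprD [X in fun_of_fin X]addrACA subrr add0r -sumrB sum_ffunE big1 // => j _.
(* The derivative of a factor from [V2] splits into a part in [V2], which cancels, and a part in
   [V1], whose wedge vanishes at [t]. *)
rewrite block_catr [N D _]block_decomp wedge_updD.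
rewrite prr_nabla block_prrK block_cat_updr block_mul_wedge addrK.
exact: wedge_block_cat_updr_inl.
Qed.

Lemma block_mul_supp x y t : ~~ block_piece t -> block_mul x y t = 0.
Proof.
move=> tE; rewrite sum_ffunE big1 // => s _; rewrite sum_ffunE big1 // => r _.
by rewrite ffunE (wedge_block_cat_supp _ _ tE) scaler0.
Qed.

Lemma block_mul_incr x y s r : block_mul x y (block_incr s r) = x s * y r.
Proof.
rewrite sum_ffunE (bigD1 s) //= [X in _ + X]big1 ?addr0; last first.
  move=> s' /negPf ss'; rewrite sum_ffunE big1 // => r' _.
  by rewrite ffunE wedge_block_cat !wedge_basis ss' mul0r scaler0.
rewrite sum_ffunE (bigD1 r) //= [X in _ + X]big1 ?addr0; last first.
  move=> r' /negPf rr'.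
  by rewrite ffunE wedge_block_cat !wedge_basis rr' mulr0 scaler0.
by rewrite ffunE wedge_block_cat !wedge_basis !eqxx mulr1 [_ *: _]mulr1.
Qed.

Notation piece_conn := (sub_conn (conn_nabla (ext_conn (m + q) W)) block_piece).

(** Pairs of index sets [(s, r)] correspond to the indices of the piece through [block_incr], so the
    wedge product matches bases; the inverse [h] reads off the coordinates at [block_incr s r]. *)
Lemma iso_block_piece :
  iso (tensor_conn (ext_conn m V1) (ext_conn q V2)) piece_conn.
Proof.
pose f (x : ext_conn m V1) (y : ext_conn q V2) : piece_conn :=
  fres block_piece (block_mul x y).
pose es s : ext_conn m V1 := wedge (fun i => basis (val s i)).
pose er r : ext_conn q V2 := wedge (fun i => basis (val r i)).
pose h (u : piece_conn) : tensor_conn (ext_conn m V1) (ext_conn q V2) :=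
  \sum_s \sum_r fext u (block_incr s r) *: tensor (es s) (er r).
have fl c x x' y : f (c *: x + x') y = c *: f x y + f x' y.
  by rewrite /f block_mul_linl linearP.
have fr c x y y' : f x (c *: y + y') = c *: f x y + f x y'.
  by rewrite /f block_mul_linr linearP.
have fE x y : fext (f x y) = block_mul x y.
  apply/ffunP => t; rewrite fext_res; case: ifP => // /negbT tE.
  by rewrite block_mul_supp.
apply: (@tensor_iso _ _ _ _ (ext_conn m V1) (ext_conn q V2) piece_conn f h) => //.
- move=> c u u'; rewrite /h scaler_sumr -big_split; apply: eq_bigr => s _.
  rewrite scaler_sumr -big_split; apply: eq_bigr => r _ /=.
  by rewrite linearP !ffunE -/(fext u _) -/(fext u' _) scalerDl scalerA.
- move=> D x y; rewrite /= /sub_nabla fE; apply/ffunP => t.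
  rewrite ffunE nabla_block_mul; last exact: (svalP t).
  by rewrite /f !ffunE.
- move=> x y; rewrite /h.
  under eq_bigr do under eq_bigr do rewrite fE block_mul_incr.
  rewrite [in RHS](ext_sumE x) tensor_suml; apply: eq_bigr => s _.
  rewrite [in RHS](ext_sumE y) tensor_sumr; apply: eq_bigr => r _.
  by rewrite tensorZl tensorZr scalerA.
move=> u; rewrite /h.
have L0 : tensor_lift f 0 = 0.
  by apply: big1 => i _; apply: big1 => j _; rewrite mxE scale0r.
rewrite (big_morph _ (tensor_liftD f) L0).
under eq_bigr do rewrite (big_morph _ (tensor_liftD f) L0).
have LE s r c : tensor_lift f (c *: tensor (es s) (er r)) = c *: f (es s) (er r).
  by rewrite -[X in tensor_lift f X]addr0 tensor_liftP L0 addr0 tensor_liftE.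
under eq_bigr do under eq_bigr do rewrite LE.
apply/ffunP => t.
have [s0 [r0 tE]] : exists s r, val t = block_incr s r.
  exact: block_incr_surj (svalP t).
have fesE s r : f (es s) (er r) t = ((s == s0) && (r == r0))%:R.
  by rewrite /f ffunE tE block_mul_incr !wedge_basis -natrM mulnb.
rewrite sum_ffunE (bigD1 s0) //= [X in _ + X]big1 ?addr0; last first.
  move=> s /negPf ss0; rewrite sum_ffunE big1 // => r _.
  by rewrite ffunE fesE ss0 scaler0.
rewrite sum_ffunE (bigD1 r0) //= [X in _ + X]big1 ?addr0; last first.
  by move=> r /negPf rr0; rewrite ffunE fesE rr0 andbF scaler0.
by rewrite ffunE fesE !eqxx [_ *: _]mulr1 -tE ffunE valK.
Qed.

Lemma K0_class_block_piece :
  K0_class piece_conn = K0_class (ext_conn m V1) * K0_class (ext_conn q V2).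
Proof. by rewrite -(K0_class_iso iso_block_piece) -K0_class_tensor. Qed.

End Piece.

Lemma ext_series_block l : ext_series W l =
  \sum_(i < l.+1) ext_series V1 i * ext_series V2 (l - i).
Proof.
rewrite /ext_series (@K0_class_filtration _ _ _ _ _ (conn_nabla (ext_conn l W))
  (fun m => @block_ge l m) l.+1).
(* The pieces are typed over a sum [m + q], so [l] is replaced by [i + q] with [q] generalized from
   [l - i]. *)
- apply: eq_bigr => -[i /= il] _; move: il; rewrite ltnS => /subnKC.
  move: (l - i)%N => q; case: l /; exact: K0_class_block_piece.
- by move=> t; rewrite /block_ge; apply/forallP.
- by move=> t; rewrite /block_ge ltnn.
- move=> m t /andP[ml /forallP tm]; rewrite unfold_in /block_ge (ltnW ml).
  by apply/forallP => c; apply/implyP => cm; rewrite (implyP (tm c)) // ltnW.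
- by move=> m; apply: block_ge_stable.
Qed.

End BlockConnection.

(** * Exterior powers and short exact sequences *)

Section ExteriorFunctoriality.
Variables (K : fieldType) (p : nat) (k : divringClosed K) (g : pLieAlg p k).
Variable l : nat.
Implicit Types V W : conn g.

Definition ext_map V W (f : 'Hom(V, W)) (x : ext_space l V) : ext_space l W :=
  \sum_s x s *: wedge (fun i => f (basis (val s i))).

Lemma ext_map_linear V W (f : 'Hom(V, W)) : linear (ext_map f).
Proof.
move=> c x y; rewrite /ext_map scaler_sumr -big_split; apply: eq_bigr => s _ /=.
by rewrite !ffunE scalerDl scalerA.
Qed.

HB.instance Definition _ V W f :=
  GRing.isLinear.Build K _ _ _ (@ext_map V W f) (@ext_map_linear V W f).

Lemma ext_map_wedge V W (f : 'Hom(V, W)) v : ext_map f (wedge v) = wedge (f \o v).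
Proof.
apply/eqP; rewrite -subr_eq0; apply/eqP.
apply: (@Phi_eq0 _ _ _ _ l V _ (fun v => ext_map f (wedge v) - wedge (f \o v))) => {v}.
- move=> v i c x y; rewrite wedge_lin ext_map_linear.
  have updf z : f \o upd v i z = upd (f \o v) i (f z).
    by apply/funext => j; rewrite /upd /=; case: eqP.
  by rewrite !updf linearP wedge_lin scalerBr opprD addrACA.
- move=> v i j ij vij; rewrite (wedge_alt ij vij) (@wedge_alt _ _ _ _ _ _ _ i j) //=.
    rewrite subr0; apply: big1 => s _; by rewrite ffunE scale0r.
  by rewrite vij.
move=> s; rewrite /ext_map (bigD1 s) //= [X in _ + X - _]big1 ?addr0.
  by rewrite wedge_basis eqxx scale1r subrr.
by move=> t /negPf ts; rewrite wedge_basis eq_sym ts scale0r.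
Qed.

Lemma ext_ind V (U : lmodType K) (f h : ext_space l V -> U) :
  linear f -> linear h -> (forall v, f (wedge v) = h (wedge v)) -> f =1 h.
Proof.
by move=> fl hl fh x; rewrite (ext_sumE x) !linear_sumZ //; apply: eq_bigr => s _; rewrite fh.
Qed.

Lemma iso_ext V W : iso V W -> iso (ext_conn l V) (ext_conn l W).
Proof.
case=> f [h [fD hf fh]].
apply: (@mk_iso _ _ _ _ (ext_conn l V) (ext_conn l W) (ext_map f) (ext_map h)).
- exact: ext_map_linear.
- exact: ext_map_linear.
- move=> D x; apply/eqP; rewrite -subr_eq0; apply/eqP.
  (* The terms in [D c] cancel in this defect, so it is [K]-linear and can be tested on wedges. *)
  pose F y : ext_space l W := ext_map f (conn_nabla (ext_conn l V) D y) -
    conn_nabla (ext_conn l W) D (ext_map f y).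
  rewrite -[LHS]/(F x); apply: (@ext_ind V _ F (fun=> 0)).
  + move=> c y z; rewrite /F nablaP !ext_map_linear nablaP opprD [LHS]addrACA.
    rewrite -scalerBr; congr (_ + _).
    by rewrite opprD [LHS]addrACA subrr add0r.
  + by move=> c y z; rewrite scaler0 addr0.
  move=> v; rewrite /F ext_map_wedge /= !ext_nabla_wedge.
  apply/eqP; rewrite subr_eq0 linear_sum; apply/eqP; apply: eq_bigr => i _ /=.
  rewrite ext_map_wedge -fD; congr wedge; apply/funext => j; rewrite /upd /=.
  by case: eqP.
- apply: ext_ind => [c x y|c x y|v] //; first by rewrite !ext_map_linear.
  by rewrite !ext_map_wedge; congr wedge; apply/funext => i /=.
apply: ext_ind => [c x y|c x y|v] //; first by rewrite !ext_map_linear.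
by rewrite !ext_map_wedge; congr wedge; apply/funext => i /=.
Qed.

End ExteriorFunctoriality.

Section ShortExact.
Variables (K : fieldType) (p : nat) (k : divringClosed K) (g : pLieAlg p k).
Variables V' V V'' : conn g.
Variables (i : 'Hom(V', V)) (q : 'Hom(V, V'')).

Lemma ext_series_iso (U W : conn g) : iso U W -> ext_series U = ext_series W.
Proof. by move=> UW; apply/funext => l; apply/K0_class_iso/iso_ext. Qed.

(** A [K]-linear splitting transports the connection of [V] to the product of [V'] and [V''], where
    exactness makes it block triangular. *)
Lemma ext_series_ses : @short_exact K p k g V' V V'' i q ->
  ext_series V = fps_mul (ext_series V') (ext_series V'').
Proof.
move=> /short_exact_split[ci cq [r [s [ri qs qi irsq]]]].
(* Evaluating [irsq] at [s x] gives [i (r (s x)) = 0], and [i] is injective. *)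
have rs x : r (s x) = 0.
  rewrite -(ri (r (s x))) (_ : i _ = 0) ?linear0 //.
  by apply: (addIr (s (q (s x)))); rewrite irsq qs add0r.
pose phi v : (V' * V'')%type := r2v (row_mx (v2r (r v)) (v2r (q v))).
pose psi (x : (V' * V'')%type) : V :=
  i (r2v (lsubmx (v2r x : 'rV_(dim V' + dim V'')))) +
  s (r2v (rsubmx (v2r x : 'rV_(dim V' + dim V'')))).
have psiP c u v : psi (c *: u + v) = c *: psi u + psi v.
  rewrite /psi; have -> : v2r (c *: u + v) = c *: v2r u + v2r v :> 'rV_(dim V' + dim V'').
    exact: linearP.
  by rewrite !linearP /= addrACA scalerDr.
have phiK : cancel phi psi.
  by move=> v; rewrite /psi r2vK row_mxKl row_mxKr !v2rK irsq.
have rpsi x : r (psi x) = r2v (lsubmx (v2r x : 'rV_(dim V' + dim V''))).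
  by rewrite /psi linearD /= ri rs addr0.
have qpsi x : q (psi x) = r2v (rsubmx (v2r x : 'rV_(dim V' + dim V''))).
  by rewrite /psi linearD /= qi qs add0r.
have psiK : cancel psi phi.
  move=> x; apply: v2r_inj; rewrite r2vK rpsi qpsi !r2vK; exact: hsubmxK.
have phiP c u v : phi (c *: u + v) = c *: phi u + phi v.
  by apply: (can_inj psiK); rewrite psiP !phiK.
have phiD u v : phi (u + v) = phi u + phi v by have := phiP 1 u v; rewrite !scale1r.
have psiD u v : psi (u + v) = psi u + psi v by have := psiP 1 u v; rewrite !scale1r.
have psiZ c u : psi (c *: u) = c *: psi u.
  by apply: (addIr (psi 0)); rewrite -psiP -psiD.
pose N D x := phi (conn_nabla V D (psi x)).
have ND D u v : N D (u + v) = N D u + N D v.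
  by rewrite /N psiD nablaD phiD.
have NC c D1 D2 v : N (elt_comb c D1 D2) v = c *: N D1 v + N D2 v.
  by rewrite /N nabla_comb phiP.
have NL (D : pLie_elt g) c v : N D (c *: v) = c *: N D v + D c *: v.
  rewrite /N psiZ nabla_Leibniz phiP; congr (_ + _).
  by apply: (can_inj psiK); rewrite phiK psiZ.
pose W := mk_connection ND NC NL.
have VW : iso V (Conn W).
  apply: (@mk_iso _ _ _ _ V (Conn W) phi psi) => //.
  by move=> D v /=; rewrite /N phiK.
rewrite (ext_series_iso VW); apply/funext => l; apply: ext_series_block.
- move=> D v; rewrite /= /N /block_inl /psi r2vK row_mxKl row_mxKr linear0.
  by rewrite (linear0 s) addr0 v2rK -ci /phi ri qi linear0.
- move=> D x; rewrite /= /N /block_prr r2vK row_mxKr v2rK cq.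
  by rewrite qpsi.
Qed.

End ShortExact.

(** * The group of power series with constant term 1 *)

(** [K0_lift] takes values in a [zmodType]; packaging the constant term makes the multiplicative
    group of series such a target. *)
Record unit_series (R : comNzRingType) := UnitSeries {
  series_coef :> nat -> R;
  series_coef0 : series_coef 0 = 1
}.

HB.instance Definition _ R := gen_eqMixin (unit_series R).
HB.instance Definition _ R := gen_choiceMixin (unit_series R).

Section UnitSeries.
Variable R : comNzRingType.
Implicit Types f h : unit_series R.

Lemma series_coef_inj f h : series_coef f = series_coef h -> f = h.
Proof.
case: f h => [f f0] [h h0] /= fh; case: h / fh h0 => h0.
by congr UnitSeries; exact: Prop_irrelevance.
Qed.

Lemma series_mul_subproof f h : fps_mul f h 0 = 1.
Proof. by rewrite fps_mul_coef0 !series_coef0 mulr1. Qed.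

Lemma series_inv_subproof f : fps_inv f 0 = 1.
Proof. exact: fps_comp_coef0. Qed.

Definition series_one : unit_series R := @UnitSeries R (@fps_one R) erefl.
Definition series_mul f h := UnitSeries (series_mul_subproof f h).
Definition series_inv f := UnitSeries (series_inv_subproof f).

Lemma series_mulA : associative series_mul.
Proof. by move=> f h e; apply/series_coef_inj/fps_mulA. Qed.
Lemma series_mulC : commutative series_mul.
Proof. by move=> f h; apply/series_coef_inj/fps_mulC. Qed.
Lemma series_mul1 : left_id series_one series_mul.
Proof. by move=> f; apply/series_coef_inj/fps_mul1. Qed.
Lemma series_mulV : left_inverse series_one series_inv series_mul.
Proof. by move=> f; apply/series_coef_inj/fps_invK/series_coef0. Qed.

(* The multiplicative group of series with constant term 1, written additively. *)
HB.instance Definition _ := GRing.isZmodule.Build (unit_series R)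
  series_mulA series_mulC series_mul1 series_mulV.

Lemma series_coefD f h : series_coef (f + h) = fps_mul f h.
Proof. by []. Qed.

Lemma series_coefMn f n : series_coef (f *+ n) = fps_exp f n.
Proof. by elim: n => // n IH; rewrite mulrS series_coefD IH. Qed.

Lemma series_coefMz f n : series_coef (f *~ n) = fps_expz f n.
Proof.
case: n => n; first by rewrite -pmulrn series_coefMn.
by rewrite NegzE mulrNz -pmulrn -mulNrn series_coefMn.
Qed.

Lemma series_coef_sum I (r : seq I) (F : I -> unit_series R) :
  series_coef (\sum_(i <- r) F i) =
  \big[@fps_mul R/@fps_one R]_(i <- r) series_coef (F i).
Proof. exact: (big_morph (@series_coef R)). Qed.

Lemma series_comp_subproof (h : nat -> R) f : fps_comp f h 0 = 1.
Proof. by rewrite fps_comp_coef0 series_coef0. Qed.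

Definition series_comp (h : nat -> R) f := UnitSeries (series_comp_subproof h f).

Lemma series_compD (h : nat -> R) : h 0 = 0 -> {morph series_comp h : f e / f + e}.
Proof. by move=> h0 f e; apply/series_coef_inj; rewrite /= fps_comp_mul. Qed.

End UnitSeries.

Lemma additiveB (U U' : zmodType) (f : U -> U') :
  {morph f : x y / x + y} -> {morph f : x y / x - y}.
Proof. by move=> fD x y; apply: (addIr (f y)); rewrite -fD !subrK. Qed.

(** * Power series under a ring morphism of coefficients *)

Section SeriesMorphism.
Variables (R S : comNzRingType) (phi : {rmorphism R -> S}).

Lemma fps_mul_map (f h : nat -> R) :
  phi \o fps_mul f h = fps_mul (phi \o f) (phi \o h).
Proof.
apply/funext => n; rewrite /= /fps_mul rmorph_sum.
by apply: eq_bigr => i _; rewrite rmorphM.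
Qed.

Lemma fps_one_map : phi \o @fps_one R = @fps_one S.
Proof. by apply/funext => n; rewrite /= rmorph_nat. Qed.

Lemma fps_exp_map (f : nat -> R) m : phi \o fps_exp f m = fps_exp (phi \o f) m.
Proof.
elim: m => [|m IH]; first exact: fps_one_map.
by rewrite -[LHS]/(phi \o fps_mul f (fps_exp f m)) fps_mul_map IH.
Qed.

Lemma fps_comp_map (f h : nat -> R) :
  phi \o fps_comp f h = fps_comp (phi \o f) (phi \o h).
Proof.
apply/funext => n; rewrite /= /fps_comp rmorph_sum.
by apply: eq_bigr => i _; rewrite rmorphM -fps_exp_map.
Qed.

Lemma fps_u_map : phi \o @fps_u R = @fps_u S.
Proof. by rewrite !fps_uE; apply/funext => n; rewrite /= rmorph_nat. Qed.

Lemma series_map_subproof (f : unit_series R) : (phi \o f) 0 = 1.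
Proof. by rewrite /= series_coef0 rmorph1. Qed.

Definition series_map f := UnitSeries (series_map_subproof f).

Lemma series_mapD : {morph series_map : f h / f + h}.
Proof. by move=> f h; apply/series_coef_inj; rewrite /= fps_mul_map. Qed.

End SeriesMorphism.

(** * Exterior powers in degrees 0, 1 and above the dimension *)

Section SmallExteriorPowers.
Variables (K : fieldType) (p : nat) (k : divringClosed K) (g : pLieAlg p k).
Variable V : conn g.

Lemma iso_ext0 : iso (ext_conn 0 V) (theta g).
Proof.
pose f0 : {ffun 'I_0 -> 'I_(dim V)} := ffun0 (card_ord 0).
have f0P : [forall i : 'I_0, forall j : 'I_0, (i < j)%N ==> (f0 i < f0 j)%N].
  by apply/forallP => -[].
pose s0 : incr 0 (dim V) := exist _ f0 f0P.
have s0E s : s = s0 by apply/val_inj/ffunP => -[].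
apply: (@mk_iso _ _ _ _ (ext_conn 0 V) (theta g) (fun x : ext_space 0 V => x s0)
  (fun c => [ffun=> c])).
- by move=> c x y; rewrite !ffunE.
- by move=> c x y; apply/ffunP => s; rewrite !ffunE.
- move=> D x; rewrite /= sum_ffunE (bigD1 s0) // [X in _ + X = _]big1 ?addr0.
    by rewrite big_ord0 scaler0 addr0 ffunE wedge_basis eqxx [_ *: _]mulr1.
  by move=> s; rewrite (s0E s) eqxx.
- by move=> x; apply/ffunP => s; rewrite ffunE (s0E s).
by move=> c; rewrite ffunE.
Qed.

Lemma ext_series0 : ext_series V 0 = 1.
Proof. exact: K0_class_iso iso_ext0. Qed.

Lemma iso_ext1 : iso V (ext_conn 1 V).
Proof.
have sP (i : 'I_(dim V)) : [forall a : 'I_1, forall b : 'I_1, (a < b)%N ==>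
    ([ffun=> i] a < ([ffun=> i] b : 'I_(dim V)))%N].
  by apply/'forall_forallP => a b; rewrite !ord1.
pose s i : incr 1 (dim V) := exist _ [ffun=> i] (sP i).
have sE (t : incr 1 (dim V)) : t = s (val t 0).
  by apply/val_inj/ffunP => a; rewrite ffunE ord1.
pose w x : ext_space 1 V := wedge (fun=> x).
have updw x : wedge (upd (fun=> 0) 0 x) = w x.
  by congr wedge; apply/funext => a; rewrite (ord1 a) upd_same.
have wE x t : w x t = v2r x 0 (val t 0) by rewrite ffunE det_mx11 mxE.
have bE c i j : v2r (c *: basis i : V) 0 j = c * (j == i)%:R.
  by rewrite linearZ mxE /= /basis r2vK mxE eqxx.
apply: (@mk_iso _ _ _ _ V (ext_conn 1 V) w
  (fun x : ext_space 1 V => \sum_i x (s i) *: basis i)).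
- by move=> c x y; rewrite -!updw wedge_lin.
- move=> c x y; rewrite scaler_sumr -big_split; apply: eq_bigr => i _ /=.
  by rewrite !ffunE scalerDl scalerA.
- move=> D x; rewrite /= ext_nabla_wedge big_ord1; congr wedge.
  by apply/funext => a; rewrite (ord1 a) upd_same.
- move=> x; rewrite [RHS]basis_sum; apply: eq_bigr => i _.
  by rewrite wE ffunE.
move=> x; apply/ffunP => t; rewrite wE linear_sum summxE.
rewrite (bigD1 (val t 0)) //= big1 ?addr0.
  by rewrite bE eqxx mulr1 -sE.
by move=> i /negPf ti; rewrite bE eq_sym ti mulr0.
Qed.

Lemma ext_series1 : ext_series V 1 = K0_class V.
Proof. exact/esym/K0_class_iso/iso_ext1. Qed.

Lemma ext_series_gt l : (dim V < l)%N -> ext_series V l = 0.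
Proof.
move=> ltl; apply: K0_class_dim0 => v; apply/ffunP => s.
have := leq_card _ (@incr_inj _ _ s); rewrite !card_ord leqNgt ltl //.
Qed.

End SmallExteriorPowers.

(** * Lambda and gamma operations on K_0 *)

Section LambdaSeries.
Variables (K : fieldType) (p : nat) (k : divringClosed K) (g : pLieAlg p k).
Implicit Types (V : conn g) (x y : K0 g).

Definition ext_unit V : unit_series (K0 g) := UnitSeries (ext_series0 V).

Lemma ses_additive_ext : ses_additive (fun z : gen g => ext_unit (gen_conn z)).
Proof. by move=> x' x x'' i q ses; apply/series_coef_inj/(ext_series_ses ses). Qed.

(** As a lift to the group of series, [lambda_t] inherits from [ses_additive_ext] both its
    independence of representatives and the passage from sums to products. *)
Definition lambda_unit x : unit_series (K0 g) :=
  K0_lift (fun z : gen g => ext_unit (gen_conn z)) x.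

Lemma lambda_unitE x : lambda_t x = lambda_unit x.
Proof.
rewrite /lambda_unit /K0_lift /freeg_lift series_coef_sum.
by apply: eq_bigr => z _; rewrite series_coefMz.
Qed.

Lemma lambda_unitB : {morph lambda_unit : x y / x - y}.
Proof. exact: K0_liftB ses_additive_ext. Qed.

Lemma lambda_unit_class V : lambda_unit (K0_class V) = ext_unit V.
Proof.
rewrite (K0_class_iso (iso_gen_of V)) /lambda_unit (K0_lift_class _ ses_additive_ext).
exact/series_coef_inj/esym/ext_series_iso/iso_gen_of.
Qed.

Definition gamma_unit x : unit_series (K0 g) :=
  series_comp (@fps_u (K0 g)) (lambda_unit x).

Lemma gamma_unitE x l : gamma l x = gamma_unit x l.
Proof. by rewrite /gamma /gamma_t lambda_unitE. Qed.

Lemma gamma_unitB : {morph gamma_unit : x y / x - y}.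
Proof.
move=> x y; rewrite /gamma_unit lambda_unitB.
by apply: (additiveB (series_compD _)); rewrite fps_uE.
Qed.
HB.instance Definition _ :=
  GRing.isZmodMorphism.Build _ _ gamma_unit gamma_unitB.

Lemma K0_rankB : {morph (@K0_rank _ _ _ g) : x y / x - y}.
Proof. exact: K0_liftB (@ses_additive_rank _ _ _ g). Qed.
HB.instance Definition _ :=
  GRing.isZmodMorphism.Build _ _ (@K0_rank _ _ _ g) K0_rankB.

Lemma K0_dE x : K0_d x = (K0_rank x)%:~R. Proof. by []. Qed.

Definition K0_red x : K0 g := x - K0_d x.

Lemma K0_redD x y : K0_red (x + y) = K0_red x + K0_red y.
Proof. by rewrite /K0_red !K0_dE raddfD /= mulrzDr opprD addrACA. Qed.

Lemma gammaD x y l :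
  gamma l (x + y) = \sum_(i < l.+1) gamma i x * gamma (l - i)%N y.
Proof.
rewrite gamma_unitE raddfD series_coefD.
by apply: eq_bigr => i _; rewrite !gamma_unitE.
Qed.

Lemma chernE l x : chern l x = (-1) ^+ l * gamma l (K0_red x).
Proof. by []. Qed.

Lemma chernD x y l :
  chern l (x + y) = \sum_(i < l.+1) chern i x * chern (l - i)%N y.
Proof.
rewrite chernE K0_redD gammaD mulr_sumr; apply: eq_bigr => i _.
have il : (i <= l)%N by rewrite -ltnS.
by rewrite !chernE mulrACA -exprD subnKC.
Qed.

(** The series of exterior powers of the trivial connection is 1 + t, so its gamma series is 1 + u =
    1/(1 - t); the opposite is the multiplicative inverse. *)
Lemma gamma_unit_theta :
  series_coef (- gamma_unit 1) = fps_sub (@fps_one (K0 g)) (@fps_X _).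
Proof.
have c0 : fps_sub (@fps_one (K0 g)) (@fps_X _) 0 = 1 by rewrite /fps_sub subr0.
pose w := UnitSeries c0; suff -> : - gamma_unit 1 = w by [].
apply: (addrI (gamma_unit 1)); rewrite subrr; apply: series_coef_inj.
rewrite series_coefD /gamma_unit /= lambda_unit_class /=.
apply: esym; apply: etrans (fps_geometric _); congr fps_mul.
apply/funext => n; rewrite /fps_comp fps_uE.
have thetaE m : ext_series (theta g) m = (m < 2)%:R.
  case: m => [|[|m]]; first exact: ext_series0; first exact: ext_series1.
  by rewrite ext_series_gt.
case: n => [|n]; first by rewrite big_ord1 thetaE mulr1.
rewrite 2!big_ord_recl /= big1 => [|i _]; last by rewrite thetaE mul0r.
rewrite !thetaE !mul1r addr0 /fps_exp /= fps_mulC fps_mul1 /=.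
by rewrite add0r.
Qed.

(* [γ_t([V] - e) = Σ_m [∧^m V] u^m (1 - t)^e = Σ_m [∧^m V] t^m (1 - t)^(e - m)] *)
Lemma gamma_red_class V l : (dim V < l)%N -> gamma l (K0_red (K0_class V)) = 0.
Proof.
set e := dim V => el; rewrite gamma_unitE /K0_red K0_dE K0_rank_class dimvf.
rewrite -/e -pmulrn raddfB raddfMn -mulNrn series_coefD series_coefMn.
rewrite gamma_unit_theta /= lambda_unit_class /=.
pose U := fps_trunc l (@fps_u (K0 g)).
pose L := \poly_(i < e.+1) ext_series V i.
have u0 : @fps_u (K0 g) 0 = 0 by rewrite fps_uE.
have VL : eq_upto l (ext_series V) L.
  move=> n _; rewrite coef_poly; case: ltnP => // en.
  by rewrite ext_series_gt.
have uU : eq_upto l (@fps_u (K0 g)) U by exact: eq_upto_trunc.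
have XX : eq_upto l (fps_sub (@fps_one (K0 g)) (@fps_X _)) (1 - 'X).
  by apply: eq_upto_sub; [exact: eq_upto_one|move=> n _; rewrite coefX].
rewrite (eq_upto_mul (eq_upto_comp u0 VL uU) (eq_upto_exp e XX) (leqnn l)).
(* [U] is u cut after degree [l], so u (1 - t) = t survives only modulo t^(l+1). *)
have UX : eq_upto l (fun n => (U * (1 - 'X))`_n) 'X.
  by move=> n nN; rewrite -(eq_upto_mul uU XX nN) fps_u_mul coefX.
have UXn m : eq_upto l (fun n => ((U * (1 - 'X)) ^+ m)`_n) 'X^m.
  elim: m => [|m IH]; first by move=> n _; rewrite !expr0.
  by rewrite exprS [in X in eq_upto _ _ X]exprS; apply: eq_upto_coef_mul.
rewrite /L poly_def linear_sum mulr_suml coef_sum big1 // => i _.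
rewrite /= linearZ /= comp_Xn_poly -scalerAl coefZ.
have ie : (i <= e)%N by rewrite -ltnS.
have -> : U ^+ i * (1 - 'X) ^+ e = (U * (1 - 'X)) ^+ i * (1 - 'X) ^+ (e - i).
  by rewrite exprMn -mulrA -exprD subnKC.
rewrite (@eq_upto_coef_mul _ l _ _ _ ((1 - 'X) ^+ (e - i)) (UXn i)) //.
rewrite coefXnM ltnNge (leq_trans ie (ltnW el)) /= nth_default ?mulr0 //.
apply: leq_trans (size_poly_exp_leq _ _) _.
have s2 : (size (1 - 'X : {poly K0 g})).-1 = 1%N.
  by rewrite -opprB size_polyN -polyC1 size_XsubC.
by rewrite s2 mul1n ltn_sub2r // (leq_ltn_trans ie).
Qed.

Lemma chern_gt_rank x l : effective x -> K0_rank x < l%:Z -> chern l x = 0.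
Proof.
(* This property is stable under sums: if j > a + b, each term of [gammaD] has i > a or j - i > b.
   Differences would not preserve it, whence effectivity. *)
pose good y := exists2 e : nat, K0_rank y = e &
  forall j, (e < j)%N -> gamma j (K0_red y) = 0.
suff good_eff : effective x -> good x.
  move=> /good_eff[e xe x0]; rewrite xe ltz_nat => el.
  by rewrite chernE x0 ?mulr0.
have good0 : good 0.
  exists 0%N; first exact: raddf0.
  move=> [|j] // _; rewrite gamma_unitE /K0_red K0_dE [K0_rank 0]raddf0 subr0.
  by rewrite [gamma_unit 0]raddf0.
have goodD y z : good y -> good z -> good (y + z).
  case=> [a ya y0] [b zb z0]; exists (a + b)%N.
    by rewrite [K0_rank _]raddfD /= ya zb PoszD.
  move=> j abj; rewrite K0_redD gammaD big1 // => i _.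
  have [ai|ia] := ltnP a i; first by rewrite y0 ?mul0r.
  rewrite z0 ?mulr0 //; lia.
have good_class V : good (K0_class V).
  by exists (dim V); [rewrite K0_rank_class dimvf|move=> j; apply: gamma_red_class].
case=> m [n [V [_ ->]]]; apply: big_ind => // i _.
by elim: (n i) => [|c IH]; rewrite ?mulr0n // mulrS; apply: goodD.
Qed.
End LambdaSeries.

(** * Compatibility with restriction to a subalgebra *)

Section Restriction.
Variables (K : fieldType) (p : nat) (k : divringClosed K).
Variables (h g : pLieAlg p k) (F : lie_incl h g).

Lemma K0_resB : {morph (K0_res F) : x y / x - y}.
Proof. exact: K0_liftB (@ses_additive_res _ _ _ _ _ F). Qed.

HB.instance Definition _ :=
  GRing.isZmodMorphism.Build _ _ (K0_res F) K0_resB.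

(** Restriction commutes with tensor and exterior powers on the nose for spaces and operators; only
    the proof components differ, and passing to an isomorphism disregards them. *)
Lemma iso_eq_nabla (S : vectType K) (N N' : connection h S) :
  (forall D v, N D v = N' D v) -> iso (Conn N) (Conn N').
Proof. by move=> NN; apply: (@mk_iso _ _ _ _ (Conn N) (Conn N') id id). Qed.

Lemma K0_res1 : K0_res F 1 = 1.
Proof. by rewrite K0_res_class; apply: K0_class_iso; apply: iso_eq_nabla. Qed.

Lemma K0_resM : {morph (K0_res F) : x y / x * y}.
Proof.
move=> x y; move: x; apply: K0_ext => [a b|a b|v].
- by rewrite mulrBl K0_resB.
- by rewrite K0_resB mulrBl.
move: y; apply: K0_ext => [a b|a b|w].
- by rewrite mulrBr K0_resB.
- by rewrite K0_resB mulrBr.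
rewrite !K0_res_class -[_ * _]/(K0_mul _ _) -[RHS]/(K0_mul _ _) !K0_class_tensor K0_res_class.
by apply: K0_class_iso; apply: iso_eq_nabla.
Qed.

HB.instance Definition _ :=
  GRing.isMonoidMorphism.Build _ _ (K0_res F) (K0_res1, K0_resM).

Lemma lambda_unit_res x :
  lambda_unit (K0_res F x) = series_map (K0_res F) (lambda_unit x).
Proof.
move: x; apply: K0_ext => [x y|x y|z].
- by rewrite K0_resB lambda_unitB.
- by rewrite lambda_unitB (additiveB (@series_mapD _ _ _)).
rewrite K0_res_class !lambda_unit_class; apply/series_coef_inj/funext => l /=.
rewrite K0_res_class; apply: K0_class_iso; exact: iso_eq_nabla.
Qed.

Lemma gamma_res l x : K0_res F (gamma l x) = gamma l (K0_res F x).
Proof.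
rewrite !gamma_unitE /gamma_unit lambda_unit_res /=.
rewrite -[LHS]/((K0_res F \o _) l) fps_comp_map fps_u_map.
by [].
Qed.

Lemma K0_rank_res x : K0_rank (K0_res F x) = K0_rank x.
Proof.
move: x; apply: K0_ext => [x y|x y|z]; rewrite ?K0_resB ?K0_rankB //.
by rewrite K0_res_class !K0_rank_class.
Qed.

Lemma chern_res l x : K0_res F (chern l x) = chern l (K0_res F x).
Proof.
rewrite !chernE rmorphM rmorphXn rmorphN1 /= gamma_res /K0_red rmorphB /=.
by rewrite !K0_dE K0_rank_res rmorph_int.
Qed.

End Restriction.

Theorem theorem3p8 (K : fieldType) (k : divringClosed K) (p : nat)
    (charK : p \in [pchar K]) (g h : pLieAlg p k) (F : lie_incl h g)
    (x y : K0 g) (x_eff : effective x) (l : nat) :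
  [/\ chern l (x + y) = \sum_(i < l.+1) chern i x * chern (l - i)%N y,
      K0_rank x < l%:Z -> chern l x = 0
    & K0_res F (chern l x) = chern l (K0_res F x)].
Proof.
by split; [exact: chernD | exact: chern_gt_rank | exact: chern_res].
Qed.
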